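(* There is a perfect set $\mathcal{P}\subseteq 2^{\omega}$ such that every $A\in\mathcal{P}$ has finite self-information, i.e. $I(A:A)<\infty$.
   Context: $K(\cdot)$ denotes prefix-free Kolmogorov complexity (with respect to a fixed universal prefix-free machine), $K^A$ its relativization to an oracle $A\in 2^{\omega}$, and $K(\sigma,\tau)$ the prefix-free complexity of the pair $(\sigma,\tau)$ of finite binary strings. For reals $A,B\in 2^{\omega}$, the mutual information is $$I(A:B)=\log\sum_{\sigma,\tau\in 2^{<\omega}} 2^{K(\sigma)-K^A(\sigma)+K(\tau)-K^B(\tau)-K(\sigma,\tau)}.$$ A real $A$ has finite self-information if $I(A:A)<\infty$. A set of reals is perfect if it is nonempty, closed, and has no isolated points. *)

(* Defs.v *)
From HB Require Import structures.
From mathcomp Require Import all_boot all_order all_algebra.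
From mathcomp Require Import all_classical all_reals all_analysis.
From Stdlib Require Cantor.

Set Implicit Arguments.
Unset Strict Implicit.
Unset Printing Implicit Defensive.

Import Order.TTheory GRing.Theory Num.Theory.
Import numFieldNormedType.Exports.

Local Open Scope classical_set_scope.
Local Open Scope nat_scope.

Definition npair (x y : nat) : nat := Cantor.to_nat (x, y).
Definition nfst (z : nat) : nat := (Cantor.of_nat z).1.
Definition nsnd (z : nat) : nat := (Cantor.of_nat z).2.

(* Programs for the partial functions nat -> nat that are recursive in an
   oracle.  Functions of several arguments go through the Cantor pairing. *)
Inductive program : Type :=
  | PZero
  | PSucc
  | PFst
  | PSnd
  | POracle
  | PPair of program & program
  | PComp of program & program
  | PRec of program & program
  | PMu of program.

(* Partial functions are given by their graphs. *)
Fixpoint prim_rec (F G : nat -> nat -> Prop) (a n y : nat) : Prop :=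
  if n is m.+1
  then exists2 r, prim_rec F G a m r & G (npair a (npair m r)) y
  else F a y.

(* [peval A c x y]: with oracle A, program c halts on input x with output y. *)
Fixpoint peval (A : cantor_space) (c : program) (x y : nat) : Prop :=
  match c with
  | PZero => y = 0
  | PSucc => y = x.+1
  | PFst => y = nfst x
  | PSnd => y = nsnd x
  | POracle => y = nat_of_bool (A x)
  | PPair f g => exists u v, [/\ peval A f x u, peval A g x v & y = npair u v]
  | PComp f g => exists2 u, peval A g x u & peval A f u y
  | PRec f g => prim_rec (peval A f) (peval A g) (nfst x) (nsnd x) y
  | PMu f => peval A f (npair x y) 0 /\
      (forall m, m < y -> exists k, peval A f (npair x m) k.+1)
  end.

(* Bijective binary numeration, least significant digit first: a bijection
   between finite binary strings and nat. *)
Fixpoint str_code (s : bitseq) : nat :=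
  if s is b :: s' then (b + (str_code s').*2).+1 else 0.

Definition str_pair_code (s t : bitseq) : nat :=
  npair (str_code s) (str_code t).

(* The output is left as a natural number, which codes a string through
   str_code, or a pair of strings through str_pair_code; both are bijections. *)
Definition machine (c : program) (A : cantor_space) (p : bitseq) (n : nat) :
    Prop :=
  peval A c (str_code p) n.

Definition prefix_free_machine (c : program) : Prop :=
  forall (A : cantor_space) (p q : bitseq) (m n : nat),
    machine c A p m -> machine c A q n -> prefix p q -> p = q.

(* The coding prefix r depends on the simulated machine, not on the oracle. *)
Definition universal_prefix_free_machine (U : program) : Prop :=
  prefix_free_machine U /\
  forall c : program, prefix_free_machine c ->
    exists r : bitseq, forall (A : cantor_space) (p : bitseq) (n : nat),
      machine U A (r ++ p) n <-> machine c A p n.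

Definition is_complexity (U : program) (A : cantor_space) (n k : nat) : Prop :=
  (exists2 p : bitseq, size p = k & machine U A p n) /\
  (forall p : bitseq, machine U A p n -> k <= size p).

(* The default value 0 is never used when U is universal, since every number
   is then an output of U, whatever the oracle. *)
Definition complexity (U : program) (A : cantor_space) (n : nat) : nat :=
  xget 0 [set k | is_complexity U A n k].

Definition empty_oracle : cantor_space := fun=> false.

Definition K (U : program) (s : bitseq) : nat :=
  complexity U empty_oracle (str_code s).

Definition Krel (U : program) (A : cantor_space) (s : bitseq) : nat :=
  complexity U A (str_code s).

Definition Kpair (U : program) (s t : bitseq) : nat :=
  complexity U empty_oracle (str_pair_code s t).

Local Open Scope ring_scope.

Definition information_term (R : realType) (U : program) (A B : cantor_space)
    (s t : bitseq) : R :=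
  2%:R ^ ((K U s)%:Z - (Krel U A s)%:Z + (K U t)%:Z - (Krel U B t)%:Z
          - (Kpair U s t)%:Z).

Local Open Scope ereal_scope.

Definition log2e (R : realType) (x : \bar R) : \bar R :=
  lne x * ((ln 2%:R)^-1)%:E.

Definition mutual_information (R : realType) (U : program)
    (A B : cantor_space) : \bar R :=
  log2e (\esum_(st in [set: bitseq * bitseq])
           (information_term R U A B st.1 st.2)%:E).

Definition finite_self_information (R : realType) (U : program)
    (A : cantor_space) : Prop :=
  mutual_information R U A A < +oo.

(* Main.v *)
Require Import Defs.
From mathcomp Require Import all_boot all_order all_algebra.
From mathcomp Require Import all_classical all_reals all_analysis.
From mathcomp Require Import zify ring lra.
From Stdlib Require Cantor.

(**
Write [m(x) = 2^-K(x)].  The set consists of the branches of a binary tree of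
strings that is computable in the limit.  Extending a node [h] to a string [t]
makes new programs halt, and their total weight is the gain from [h] to [t].
Given [h] and [e], repeatedly replace [h] by the first extension found that
gains at least [2^-e]: by Kraft's inequality this stops after at most [2^e]
steps, and above the final node all gains are less than [2^-e].  Level [k + 1]
of the tree is obtained in this way, with precision [e_k], from the two
immediate successors of each node of level [k].

A program whose computation first appears at level [k + 1] of some branch at
some stage is turned by Kraft-Chaitin into an oracle-free description of its
output that is [d_k] bits longer.  Above one value of a level-[k] node these
programs have total weight below [2^-e_(k-1)], which compensates the number
[2^e_(k-1) + 1] of values that the last extension can take; hence [d_k] depends
on [e_0, ..., e_(k-2)] only, and [e_(k-1)] can be chosen larger than
[2 d_k + k].

For a branch [A] put [r(x) = 2^(K(x) - K^A(x))].  If the shortest [A]-program of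
[x] appears at level [k + 1], then [r(x) <= 2^(d_k + O(1))], and such [x] have
total weight at most [2^-e_(k-1)], so [sum_x r(x)^2 2^-K^A(x)] converges.  By
the coding theorem [sum_y m(x, y) <= O(m(x)) <= O(2^-K^A(x))], and
[r(x) r(y) <= r(x)^2 + r(y)^2] bounds [sum_(x, y) r(x) r(y) m(x, y)].
*)
Set Implicit Arguments.
Unset Strict Implicit.
Unset Printing Implicit Defensive.

Import Order.TTheory GRing.Theory Num.Theory.

(** * Recursive functions *)

Local Open Scope nat_scope.

Lemma nfstE x y : nfst (npair x y) = x.
Proof. by rewrite /nfst /npair Cantor.cancel_of_to. Qed.

Lemma nsndE x y : nsnd (npair x y) = y.
Proof. by rewrite /nsnd /npair Cantor.cancel_of_to. Qed.

Lemma npairK z : npair (nfst z) (nsnd z) = z.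
Proof.
rewrite /nfst /nsnd /npair -[RHS]Cantor.cancel_to_of.
by case: (Cantor.of_nat z).
Qed.

Definition nprE := (nfstE, nsndE).

Lemma nfst_le z : nfst z <= z.
Proof.
have := Cantor.to_nat_non_decreasing (nfst z) (nsnd z).
rewrite -/(npair (nfst z) (nsnd z)) npairK; lia.
Qed.

(** One program has to serve for all oracles, so a machine built from computable functions behaves
    the same under every oracle. *)
Definition computable (f : nat -> nat) :=
  exists c, forall A x y, peval A c x y <-> y = f x.

Definition decidable_set (P : nat -> bool) := computable (fun z => P z : nat).

Definition nat_iter (a : nat) (g : nat -> nat -> nat) (n : nat) : nat :=
  nat_rec (fun=> nat) a g n.

Lemma eq_computable f g : f =1 g -> computable f -> computable g.
Proof. by move=> /funext ->. Qed.

Lemma computable_fst f : computable f -> computable (fun z => nfst (f z)).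
Proof.
move=> [c cP]; exists (PComp PFst c) => A x y /=; split.
  by case=> u /cP ->.
by move=> ->; exists (f x) => //; apply/cP.
Qed.

Lemma computable_snd f : computable f -> computable (fun z => nsnd (f z)).
Proof.
move=> [c cP]; exists (PComp PSnd c) => A x y /=; split.
  by case=> u /cP ->.
by move=> ->; exists (f x) => //; apply/cP.
Qed.

Lemma computable_pair f g : computable f -> computable g ->
  computable (fun z => npair (f z) (g z)).
Proof.
move=> [c cP] [d dP]; exists (PPair c d) => A x y /=; split.
  by case=> u [v [/cP -> /dP ->]].
by move=> ->; exists (f x), (g x); split => //; [apply/cP|apply/dP].
Qed.

Lemma computable_id : computable id.
Proof.
exists (PPair PFst PSnd) => A x y /=; split.
  by case=> u [v [-> -> ->]]; rewrite npairK.
by move=> ->; exists (nfst x), (nsnd x); rewrite npairK.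
Qed.

Lemma computable_comp f g : computable f -> computable g ->
  computable (fun z => f (g z)).
Proof.
move=> [c cP] [d dP]; exists (PComp c d) => A x y /=; split.
  by case=> u /dP -> /cP ->.
by move=> ->; exists (g x); [apply/dP|apply/cP].
Qed.

Lemma computable_succ f : computable f -> computable (fun z => (f z).+1).
Proof.
by apply: (@computable_comp succn); exists PSucc.
Qed.

Lemma computable_const k : computable (fun=> k).
Proof.
elim: k => [|k IH]; first by exists PZero.
exact: computable_succ IH.
Qed.

Lemma prim_recP (F G : nat -> nat -> Prop) (f : nat) (g : nat -> nat) a n y :
  (forall y, F a y <-> y = f) -> (forall x y, G x y <-> y = g x) ->
  prim_rec F G a n y <->
  y = nat_iter f (fun m r => g (npair a (npair m r))) n.
Proof.
move=> FP GP; elim: n y => [|n IH] y //=; split.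
  by case=> r /IH -> /GP ->.
by move=> ->; exists (nat_iter f (fun m r => g (npair a (npair m r))) n);
  [apply/IH|apply/GP].
Qed.

Lemma computable_iter n f (g : nat -> nat -> nat -> nat) :
  computable n -> computable f ->
  computable (fun w => g (nfst w) (nfst (nsnd w)) (nsnd (nsnd w))) ->
  computable (fun z => nat_iter (f z) (g z) (n z)).
Proof.
move=> nC [c cP] [d dP].
have h : computable (fun w => nat_iter (f (nfst w)) (g (nfst w)) (nsnd w)).
  exists (PRec c d) => A x y /=.
  rewrite (@prim_recP _ _ (f (nfst x)) _ (nfst x) (nsnd x) y _ (dP A)) //.
  have -> // : (fun m r => g (nfst (npair (nfst x) (npair m r)))
     (nfst (nsnd (npair (nfst x) (npair m r))))
     (nsnd (nsnd (npair (nfst x) (npair m r))))) = g (nfst x).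
  by apply/funext => m; apply/funext => r; rewrite !nprE.
apply: eq_computable (computable_comp h (computable_pair computable_id nC)).
by move=> z; rewrite !nprE.
Qed.

Lemma computable2 (F : nat -> nat -> nat) f g :
  computable (fun w => F (nfst w) (nsnd w)) ->
  computable f -> computable g -> computable (fun z => F (f z) (g z)).
Proof.
move=> FC fC gC.
apply: eq_computable (computable_comp FC (computable_pair fC gC)).
by move=> z; rewrite !nprE.
Qed.

Lemma computable_fst_id : computable nfst.
Proof. exact: computable_fst computable_id. Qed.
Lemma computable_snd_id : computable nsnd.
Proof. exact: computable_snd computable_id. Qed.

Create HintDb comp.
Ltac comp := cbv beta; solve [auto 40 with comp nocore].
#[local] Hint Resolve computable_id computable_const computable_fst
  computable_snd computable_fst_id computable_snd_id computable_succ
  computable_pair : comp.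
#[local] Hint Extern 1 (computable _) =>
  match goal with H : computable ?f |- computable (fun w => ?f (@?g w)) =>
    exact (computable_comp H (g := g) ltac:(comp)) end : comp.
#[local] Hint Extern 1 (computable _) =>
  match goal with H : computable (fun w => ?F (nfst w) (nsnd w))
    |- computable (fun w => ?F (@?f w) (@?g w)) =>
    exact (computable2 (F := F) (f := f) (g := g) H ltac:(comp) ltac:(comp))
  end : comp.

Lemma computable_add f g : computable f -> computable g ->
  computable (fun z => f z + g z).
Proof.
move=> fC gC.
have h : computable (fun z => nat_iter (f z) (fun _ r => r.+1) (g z)).
  now (apply (@computable_iter _ _ (fun _ _ r => r.+1)); comp).
apply: eq_computable h => z.
by elim: (g z) => [|n /= ->]; rewrite ?addn0 ?addnS.
Qed.
#[local] Hint Resolve computable_add : comp.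

Lemma computable_mul f g : computable f -> computable g ->
  computable (fun z => f z * g z).
Proof.
move=> fC gC.
have h : computable (fun z => nat_iter 0 (fun _ r => r + f z) (g z)).
  now (apply (@computable_iter _ _ (fun z _ r => r + f z)); comp).
apply: eq_computable h => z.
by elim: (g z) => [|n /= ->]; rewrite ?muln0 // mulnS addnC.
Qed.
#[local] Hint Resolve computable_mul : comp.

Lemma computable_exp f g : computable f -> computable g ->
  computable (fun z => f z ^ g z).
Proof.
move=> fC gC.
have h : computable (fun z => nat_iter 1 (fun _ r => r * f z) (g z)).
  now (apply (@computable_iter _ _ (fun z _ r => r * f z)); comp).
apply: eq_computable h => z.
by elim: (g z) => [|n /= ->]; rewrite ?expn0 // expnS mulnC.
Qed.
#[local] Hint Resolve computable_exp : comp.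

Lemma computable_pred f : computable f -> computable (fun z => (f z).-1).
Proof.
move=> fC.
have h : computable (fun z => nat_iter 0 (fun m _ => m) (f z)).
  now (apply (@computable_iter _ _ (fun _ m _ => m)); comp).
by apply: eq_computable h => z; case: (f z).
Qed.
#[local] Hint Resolve computable_pred : comp.

Lemma computable_sub f g : computable f -> computable g ->
  computable (fun z => f z - g z).
Proof.
move=> fC gC.
have h : computable (fun z => nat_iter (f z) (fun _ r => r.-1) (g z)).
  now (apply (@computable_iter _ _ (fun z _ r => r.-1)); comp).
apply: eq_computable h => z.
by elim: (g z) => [|n /= ->]; rewrite ?subn0 // subnS.
Qed.
#[local] Hint Resolve computable_sub : comp.

Lemma computable_if (b : nat -> bool) f g :
  decidable_set b -> computable f -> computable g ->
  computable (fun z => if b z then f z else g z).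
Proof.
move=> bC fC gC.
have h : computable (fun z => b z * f z + (1 - b z) * g z).
  by rewrite /decidable_set in bC; comp.
by apply: eq_computable h => z; case: (b z); rewrite ?mul1n ?mul0n ?addn0.
Qed.

Lemma decidable_leq f g : computable f -> computable g ->
  decidable_set (fun z => f z <= g z).
Proof.
move=> fC gC; have h : computable (fun z => 1 - (f z - g z)) by comp.
by apply: eq_computable h => z; lia.
Qed.

Lemma decidable_and (b c : nat -> bool) : decidable_set b -> decidable_set c ->
  decidable_set (fun z => b z && c z).
Proof.
move=> bC cC; have h : computable (fun z => b z * c z) by apply: computable_mul.
by apply: eq_computable h => z; case: (b z); case: (c z).
Qed.

Lemma decidable_not (b : nat -> bool) : decidable_set b ->
  decidable_set (fun z => ~~ b z).
Proof.
move=> bC; have h : computable (fun z => 1 - b z).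
  by apply: computable_sub => //; exact: computable_const.
by apply: eq_computable h => z; case: (b z).
Qed.

Lemma decidable_eq f g : computable f -> computable g ->
  decidable_set (fun z => f z == g z).
Proof.
move=> fC gC.
have h := decidable_and (decidable_leq fC gC) (decidable_leq gC fC).
by apply: eq_computable h => z; rewrite eqn_leq.
Qed.
#[local] Hint Resolve computable_if decidable_leq decidable_and decidable_not
  decidable_eq : comp.

Lemma computable_nat_of_bool b : decidable_set b ->
  computable (fun z => nat_of_bool (b z)).
Proof. by []. Qed.
#[local] Hint Resolve computable_nat_of_bool : comp.

(* Keeps the index in [nat], so that unification can abstract over it. *)
Definition nsum (n : nat) (F : nat -> nat) : nat := \sum_(i < n) F i.

Lemma computable_sum n (g : nat -> nat -> nat) :
  computable n -> computable (fun w => g (nfst w) (nsnd w)) ->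
  computable (fun z => nsum (n z) (g z)).
Proof.
move=> nC gC.
have h : computable (fun z => nat_iter 0 (fun m r => r + g z m) (n z)).
  now (apply (@computable_iter _ _ (fun z m r => r + g z m)); comp).
apply: eq_computable h => z.
by rewrite /nsum; elim: (n z) => [|m /= ->]; rewrite ?big_ord0 // big_ord_recr.
Qed.

#[local] Hint Resolve computable_sum : comp.

Lemma sum_ltn q n : \sum_(i < n) (i < q) = minn q n.
Proof.
by elim: n => [|n IH]; rewrite ?big_ord0 ?minn0 // big_ord_recr /= IH; lia.
Qed.

Lemma computable_div f g : computable f -> computable g ->
  computable (fun z => f z %/ g z).
Proof.
move=> fC gC.
(* The quotient counts the [i] with [i.+1 * g z <= f z]; the factor [0 < g z] reproduces the
   convention [n %/ 0 = 0]. *)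
have h : computable (fun z => (0 < g z) * nsum (f z) (fun i => i.+1 * g z <= f z)).
  by comp.
apply: eq_computable h => z.
case: (posnP (g z)) => [->|g0]; first by rewrite divn0.
rewrite mul1n /nsum.
rewrite (eq_bigr (fun i : 'I__ => (i < f z %/ g z : nat))); last first.
  by move=> i _; rewrite leq_divRL.
by rewrite sum_ltn; apply/minn_idPl; apply: leq_div.
Qed.
#[local] Hint Resolve computable_div : comp.

Lemma decidable_odd f : computable f -> decidable_set (fun z => odd (f z)).
Proof.
move=> fC.
have h : computable (fun z => nat_iter 0 (fun _ r => 1 - r) (f z)).
  now (apply (@computable_iter _ _ (fun _ _ r => 1 - r)); comp).
apply: eq_computable h => z.
by elim: (f z) => //= n ->; case: (odd n).
Qed.
#[local] Hint Resolve decidable_odd : comp.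

Lemma decidable2 (b : nat -> nat -> bool) f g :
  decidable_set (fun w => b (nfst w) (nsnd w)) ->
  computable f -> computable g -> decidable_set (fun z => b (f z) (g z)).
Proof. exact: (@computable2 (fun x y => b x y)). Qed.
#[local] Hint Extern 1 (decidable_set _) =>
  match goal with H : decidable_set (fun w => ?b (nfst w) (nsnd w))
    |- decidable_set (fun w => ?b (@?f w) (@?g w)) =>
    exact (decidable2 (b := b) (f := f) (g := g) H ltac:(comp) ltac:(comp))
  end : comp.

(* The number [h] stands for the string it codes through [str_code].  In binary,
   [h.+1] is a leading 1 followed by the reversed string. *)
Definition slen (h : nat) : nat := nsum h (fun i => 2 ^ i.+1 <= h.+1).
Definition sbit (h i : nat) : bool := odd (h.+1 %/ 2 ^ i).
(** Appends the bit [b] at the end: its digit [b.+1] receives the place value [2 ^ slen h]. *)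
Definition srcons (h b : nat) : nat := h + 2 ^ slen h * b.+1.
(* Reads the string most significant digit first, so that the extensions of a
   string form a dyadic interval. *)
Definition smsb (h : nat) : nat :=
  nsum (slen h) (fun i => sbit h i * 2 ^ (slen h - i.+1)).
(** The prefix relation of the coded strings; disagreements are counted by a bounded sum to keep it
    decidable. *)
Definition pre (h h' : nat) : bool :=
  (slen h <= slen h') && (nsum (slen h) (fun i => sbit h i != sbit h' i) == 0).

Lemma computable_slen f : computable f -> computable (fun z => slen (f z)).
Proof. by move=> fC; rewrite /slen; comp. Qed.
#[local] Hint Resolve computable_slen : comp.

Lemma decidable_sbit f g : computable f -> computable g ->
  decidable_set (fun z => sbit (f z) (g z)).
Proof. by move=> fC gC; rewrite /sbit; comp. Qed.
#[local] Hint Resolve decidable_sbit : comp.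

Lemma computable_srcons f g : computable f -> computable g ->
  computable (fun z => srcons (f z) (g z)).
Proof. by move=> fC gC; rewrite /srcons; comp. Qed.

Lemma computable_smsb f : computable f -> computable (fun z => smsb (f z)).
Proof. by move=> fC; rewrite /smsb; comp. Qed.

Lemma decidable_bool_neq b c : decidable_set b -> decidable_set c ->
  decidable_set (fun z => b z != c z).
Proof.
move=> bC cC; have h : decidable_set (fun z => nat_of_bool (b z) != c z) by comp.
by apply: eq_computable h => z; case: (b z); case: (c z).
Qed.
#[local] Hint Resolve computable_srcons computable_smsb decidable_bool_neq : comp.

Lemma decidable_pre f g : computable f -> computable g ->
  decidable_set (fun z => pre (f z) (g z)).
Proof. by move=> fC gC; rewrite /pre; comp. Qed.
#[local] Hint Resolve decidable_pre : comp.

(* [0] means that no value was found and [y.+1] that the value is [y].  The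
   length of [h] also bounds the search of [PMu]; there the accumulator is [0]
   while searching, [1] once an undefined value was met, [y.+2] when [y] is
   found. *)
Fixpoint eval_fin (c : program) (h x : nat) : nat :=
  match c with
  | PZero => 1
  | PSucc => x.+2
  | PFst => (nfst x).+1
  | PSnd => (nsnd x).+1
  | POracle => if x < slen h then (sbit h x).+1 else 0
  | PPair f g => if eval_fin f h x * eval_fin g h x == 0 then 0
                 else (npair (eval_fin f h x).-1 (eval_fin g h x).-1).+1
  | PComp f g => if eval_fin g h x == 0 then 0 else eval_fin f h (eval_fin g h x).-1
  | PRec f g => nat_iter (eval_fin f h (nfst x))
      (fun m r => if r == 0 then 0 else eval_fin g h (npair (nfst x) (npair m r.-1)))
      (nsnd x)
  | PMu f => (nat_iter 0 (fun m st => if st == 0 then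
        if eval_fin f h (npair x m) == 0 then 1
        else if eval_fin f h (npair x m) == 1 then m.+2 else 0
      else st) (slen h)).-1
  end.

Lemma computable_eval_fin c f g : computable f -> computable g ->
  computable (fun z => eval_fin c (f z) (g z)).
Proof.
apply: computable2.
elim: c => [|||||c IHc d IHd|c IHc d IHd|c IHc d IHd|c IHc] /=; try comp.
- apply: computable_iter; try comp.
- apply: computable_pred; apply: computable_iter; try comp.
Qed.
#[local] Hint Resolve computable_eval_fin : comp.

(** * Strings as natural numbers and evaluation with a finite oracle *)

Local Open Scope nat_scope.

(** The exponents counted by [slen] are those below [k], and [k < 2 ^ k <= h.+1] puts all of them in
    the range of the sum. *)
Lemma slen_uniq h k : 2 ^ k <= h.+1 < 2 ^ k.+1 -> slen h = k.
Proof.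
move=> /andP[le_kh lt_hk]; rewrite /slen /nsum.
rewrite (eq_bigr (fun i : 'I__ => (i < k : nat))); last first.
  move=> i _; congr nat_of_bool; apply/idP/idP => ik.
    by rewrite -ltnS -(ltn_exp2l _ _ (ltnSn 1)); exact: leq_ltn_trans lt_hk.
  by apply: leq_trans le_kh; rewrite leq_exp2l.
rewrite sum_ltn; apply/minn_idPl; rewrite -ltnS.
by apply: leq_trans le_kh; apply: ltn_expl.
Qed.

Lemma slen_code s : slen (str_code s) = size s.
Proof.
apply: slen_uniq; elim: s => //= b s /andP[lo hi].
by move: lo hi; rewrite !expnS; case: b; lia.
Qed.

Lemma sbit_code s i : i < size s -> sbit (str_code s) i = nth false s i.
Proof.
elim: s i => //= b s IH [|i] lt_is; rewrite /sbit /=.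
  by rewrite expn0 divn1 /= oddD odd_double; case: b.
rewrite -IH //= expnS divnMA; congr (odd (_ %/ _)).
by case: b => /=; lia.
Qed.

Definition decode (h : nat) : bitseq := mkseq (sbit h) (slen h).

Lemma str_codeK : cancel str_code decode.
Proof.
move=> s; apply: (@eq_from_nth _ false); rewrite size_mkseq slen_code // => i lt_is.
by rewrite nth_mkseq ?slen_code // sbit_code.
Qed.

Lemma decodeK : cancel decode str_code.
Proof.
suff code_surj h : exists s, str_code s = h.
  by move=> h; case: (code_surj h) => s <-; rewrite str_codeK.
elim/ltn_ind: h => [[|h]] IH; first by exists [::].
have [|s sE] := IH h./2; first lia.
by exists (odd h :: s) => /=; rewrite sE odd_double_half.
Qed.

Lemma slen_bounds h : 2 ^ slen h <= h.+1 < 2 ^ (slen h).+1.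
Proof.
rewrite -[h]decodeK slen_code; elim: (decode h) => //= b s /andP[lo hi].
by move: lo hi; rewrite !expnS; case: b; lia.
Qed.

Lemma slen_le h : slen h <= h.
Proof.
have /andP[+ _] := slen_bounds h; have := ltn_expl (slen h) (ltnSn 1); lia.
Qed.

Lemma preP h h' :
  reflect (slen h <= slen h' /\ forall i, i < slen h -> sbit h i = sbit h' i)
          (pre h h').
Proof.
apply: (iffP andP) => -[le_hh' e]; split=> //.
  move=> i lt_ih; move: e; rewrite /nsum sum_nat_eq0 => /forallP/(_ (Ordinal lt_ih)).
  by rewrite /= eqb0 negbK => /eqP.
by rewrite /nsum sum_nat_eq0; apply/forallP => i; rewrite /= e ?eqxx.
Qed.

Lemma pre_refl h : pre h h.
Proof. by apply/preP; split. Qed.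

Lemma pre_trans h2 h1 h3 : pre h1 h2 -> pre h2 h3 -> pre h1 h3.
Proof.
move=> /preP[le12 e12] /preP[le23 e23]; apply/preP.
split=> [|i lt_i]; first exact: leq_trans le12 le23.
by rewrite e12 // e23 //; exact: leq_trans lt_i le12.
Qed.

Lemma pre_eq h h' : pre h h' -> slen h' <= slen h -> h = h'.
Proof.
move=> /preP[le e] le'; rewrite -[h]decodeK -[h']decodeK; congr str_code.
have eS : slen h = slen h' by apply/eqP; rewrite eqn_leq le le'.
apply: (@eq_from_nth _ false); rewrite !size_mkseq // => i lt_i.
by rewrite !nth_mkseq -?eS // e.
Qed.

Lemma code_cat s t : str_code (s ++ t) = str_code s + 2 ^ size s * str_code t.
Proof.
elim: s => /= [|b s ->]; first by rewrite mul1n.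
by rewrite expnS doubleD -!muln2; lia.
Qed.

Lemma srconsE h (b : bool) : srcons h b = str_code (rcons (decode h) b).
Proof.
rewrite -cats1 code_cat decodeK size_mkseq /srcons /=.
by rewrite double0 addn0.
Qed.

Lemma slen_srcons h (b : bool) : slen (srcons h b) = (slen h).+1.
Proof. by rewrite srconsE slen_code size_rcons size_mkseq. Qed.

Lemma sbit_srcons h (b : bool) : sbit (srcons h b) (slen h) = b.
Proof.
rewrite srconsE sbit_code ?size_rcons ?size_mkseq //.
by rewrite nth_rcons size_mkseq ltnn eqxx.
Qed.

Lemma pre_srcons h (b : bool) : pre h (srcons h b).
Proof.
apply/preP; rewrite slen_srcons leqnSn; split=> // i lt_i.
rewrite srconsE sbit_code ?size_rcons ?size_mkseq ?ltnS 1?ltnW //.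
by rewrite nth_rcons size_mkseq lt_i nth_mkseq.
Qed.

Definition agree (h : nat) (A : cantor_space) := forall i, i < slen h -> sbit h i = A i.

Lemma agree_pre h h' A : agree h A -> agree h' A -> slen h <= slen h' -> pre h h'.
Proof.
move=> hA hA' le; apply/preP; split=> // i lt; rewrite hA // hA' //.
exact: leq_trans lt le.
Qed.

Definition oracle_of (h : nat) : cantor_space := fun i => sbit h i.

Lemma agree_oracle_of h : agree h (oracle_of h).
Proof. by []. Qed.

Definition initial (A : cantor_space) (n : nat) : nat := str_code (mkseq A n).

Lemma slen_initial A n : slen (initial A n) = n.
Proof. by rewrite slen_code size_mkseq. Qed.

Lemma agree_initial A n : agree (initial A n) A.
Proof.
move=> i; rewrite slen_initial => lt; rewrite sbit_code ?size_mkseq //.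
by rewrite nth_mkseq.
Qed.

(** The accumulator in the [PMu] case of [eval_fin], with the search length freed from [slen h] so
    that induction on it is possible. *)
Definition mu_state f h x n := nat_iter 0 (fun m st => if st == 0 then
        if eval_fin f h (npair x m) == 0 then 1
        else if eval_fin f h (npair x m) == 1 then m.+2 else 0
      else st) n.

Lemma mu_state0 f h x n :
  mu_state f h x n = 0 <-> forall m, m < n -> 1 < eval_fin f h (npair x m).
Proof.
elim: n => [|n IH] /=; first by split.
rewrite -/(mu_state f h x n); case: eqP => [e|ne].
  split=> [h0 m|lt].
    rewrite ltnS leq_eqVlt => /predU1P[->|]; last exact: (IH.1 e).
    by move: h0; case: (eval_fin _ _ _) => [|[]].
  by have := lt n (ltnSn n); case: (eval_fin _ _ _) => [|[]].
split=> // lt; case: ne; apply/IH => m lt_mn; apply: lt; exact: ltnW.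
Qed.

Lemma mu_stateS f h x n y : mu_state f h x n = y.+2 <->
  [/\ y < n, eval_fin f h (npair x y) = 1
    & forall m, m < y -> 1 < eval_fin f h (npair x m)].
Proof.
elim: n => [|n IH] /=; first by split=> // -[].
rewrite -/(mu_state f h x n); case: eqP => [e|ne].
  have /mu_state0 lt := e; split=> [|[lt_yn ey ltm]].
    case: eqP => // _; case: eqP => // e1 [<-]; by split.
  case: (ltngtP y n) lt_yn => [lt_yn _|lt_ny|yn _]; last by rewrite -yn ey.
    by have := lt y lt_yn; rewrite ey.
  by rewrite ltnS leqNgt lt_ny.
rewrite IH; split=> [[lt ey ltm]|[lt ey ltm]]; split=> //; first exact: ltnW.
move: lt; rewrite ltnS leq_eqVlt => /predU1P[yn|//].
by case: ne; apply/mu_state0 => m; rewrite -yn; exact: ltm.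
Qed.

Lemma eval_fin_muP f h x y : eval_fin (PMu f) h x = y.+1 <->
  [/\ y < slen h, eval_fin f h (npair x y) = 1
    & forall m, m < y -> 1 < eval_fin f h (npair x m)].
Proof.
rewrite -mu_stateS /= -/(mu_state f h x (slen h)).
by case: (mu_state _ _ _ _) => [|n] //=; split => [->|[]].
Qed.

Lemma eval_fin_sound A c h x y : agree h A -> eval_fin c h x = y.+1 -> peval A c x y.
Proof.
move=> hA; elim: c x y => [|||||f IHf g IHg|f IHf g IHg|f IHf g IHg|f IHf] x y.
- by case.
- by case.
- by case.
- by case.
- by rewrite /=; case: ifP => // lt [<-]; rewrite hA.
- rewrite /=; case ef: (eval_fin f h x) => [|u]; first by rewrite mul0n.
  case eg: (eval_fin g h x) => [|v]; first by rewrite muln0.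
  by move=> [<-]; exists u, v; split; [exact: IHf|exact: IHg|].
- rewrite /=; case eg: (eval_fin g h x) => [|v] //= ef.
  by exists v; [exact: IHg|exact: IHf].
- rewrite /=; elim: (nsnd x) y => [|n IH] y /=; first exact: IHf.
  case e: (nat_iter _ _ _) => [|r] //= eg.
  by exists r; [exact: IH|exact: IHg].
- move=> /eval_fin_muP[_ e lt]; split; first exact: IHf.
  move=> m /lt; case em: (eval_fin _ _ _) => [|[|k]] // _.
  by exists k; exact: IHf.
Qed.

Lemma eval_fin_pre c h h' x y :
  pre h h' -> eval_fin c h x = y.+1 -> eval_fin c h' x = y.+1.
Proof.
move=> /preP[le e]; elim: c x y => [|||||f IHf g IHg|f IHf g IHg|f IHf g IHg|f IHf] x y //.
- rewrite /=; case: ifP => // lt [<-]; rewrite (leq_trans lt le).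
  by rewrite e.
- rewrite /=; case ef: (eval_fin f h x) => [|u]; first by rewrite mul0n.
  case eg: (eval_fin g h x) => [|v]; first by rewrite muln0.
  by rewrite (IHf _ _ ef) (IHg _ _ eg).
- rewrite /=; case eg: (eval_fin g h x) => [|v] //= ef.
  by rewrite (IHg _ _ eg) /= (IHf _ _ ef).
- rewrite /=; elim: (nsnd x) y => [|n IH] y /=; first exact: IHf.
  case er: (nat_iter _ _ _) => [|r] //= eg.
  by rewrite (IH _ er) /= (IHg _ _ eg).
- move=> /eval_fin_muP[lt e1 ltm]; apply/eval_fin_muP; split.
  + exact: leq_trans lt le.
  + exact: IHf.
  + move=> m /ltm; case em: (eval_fin f h _) => [|k] // k1.
    by rewrite (IHf _ _ em).
Qed.

(** A halting computation uses a finite part of the oracle. Asking for all sufficiently long [h]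
    lets the bounds of subcomputations be combined by a maximum. *)
Lemma eval_fin_complete A c x y : peval A c x y ->
  exists n, forall h, agree h A -> n <= slen h -> eval_fin c h x = y.+1.
Proof.
elim: c x y => [|||||f IHf g IHg|f IHf g IHg|f IHf g IHg|f IHf] x y /=.
- by move=> ->; exists 0.
- by move=> ->; exists 0.
- by move=> ->; exists 0.
- by move=> ->; exists 0.
- by move=> ->; exists x.+1 => h hA lt; rewrite lt hA.
- move=> [u [v [/IHf[n1 e1] /IHg[n2 e2] ->]]]; exists (maxn n1 n2) => h hA.
  by rewrite geq_max => /andP[/e1-> // /e2->].
- move=> [u /IHg[n2 e2] /IHf[n1 e1]]; exists (maxn n1 n2) => h hA.
  by rewrite geq_max => /andP[l1 /e2->] //=; exact: e1.
- elim: (nsnd x) y => [|n IH] y /=; first exact: IHf.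
  move=> [r /IH[n1 e1] /IHg[n2 e2]]; exists (maxn n1 n2) => h hA.
  by rewrite geq_max => /andP[/e1-> // /e2->].
- move=> [/IHf[n0 e0] lt].
  have [N eN] : exists N, forall h, agree h A -> N <= slen h ->
      forall m, m < y -> 1 < eval_fin f h (npair x m).
    elim: (y) lt => [|k IH] lt; first by exists 0.
    have [m lt_mk|N1 e1] := IH; first by apply: lt; exact: ltnW.
    have [z /IHf[N2 e2]] := lt k (ltnSn k).
    exists (maxn N1 N2) => h hA; rewrite geq_max => /andP[l1 l2] m.
    rewrite ltnS leq_eqVlt => /predU1P[->|]; first by rewrite e2.
    exact: e1.
  exists (maxn y.+1 (maxn n0 N)) => h hA; rewrite !geq_max => /and3P[ly l0 lN].
  by apply/eval_fin_muP; split=> //; [exact: e0|exact: eN].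
Qed.

Lemma peval_inj A c x y y' : peval A c x y -> peval A c x y' -> y = y'.
Proof.
move=> /eval_fin_complete[n e] /eval_fin_complete[n' e'].
have hA := @agree_initial A (maxn n n').
have := e _ hA; have := e' _ hA; rewrite !slen_initial leq_maxl leq_maxr.
by move=> /(_ isT)-> /(_ isT)[].
Qed.

(** * Kraft's inequality *)

Local Open Scope ring_scope.

Definition weight (F : realFieldType) (n : nat) : F := 2%:R^-1 ^+ n.

Lemma weight_gt0 F n : 0 < weight F n.
Proof. by rewrite exprn_gt0 // invr_gt0 ltr0n. Qed.

Lemma weight_ge0 F n : 0 <= weight F n.
Proof. exact/ltW/weight_gt0. Qed.
#[local] Hint Extern 0 (is_true (@Order.lt _ _ _ (weight _ _))) =>
  solve [apply: weight_gt0] : core.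
#[local] Hint Extern 0 (is_true (@Order.le _ _ _ (weight _ _))) =>
  solve [apply: weight_ge0] : core.

Lemma weightD F m n : weight F (m + n) = weight F m * weight F n.
Proof. exact: exprD. Qed.

Lemma weightS F n : weight F n.+1 + weight F n.+1 = weight F n.
Proof. by rewrite /weight exprS; field. Qed.

Lemma weight_exp F n : (2 ^ n)%:R * weight F n = 1.
Proof. by rewrite natrX /weight exprVn divff // expf_neq0 // pnatr_eq0. Qed.

Lemma weight_sub F m n : (m <= n)%N -> (2 ^ (n - m))%:R * weight F n = weight F m.
Proof.
by move=> le_mn; rewrite -{2}(subnK le_mn) weightD mulrA weight_exp mul1r.
Qed.

Lemma weight_le F m n : (weight F m <= weight F n) = (n <= m)%N.
Proof.
have h2 : (0 : F) < 2%:R by rewrite ltr0n.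
rewrite /weight ler_iXn2l ?invr_gt0 // invf_lt1 // ltr1n //.
Qed.

Lemma ler_sum_sub (F : realFieldType) (g : nat -> F) (s : seq nat) (P : pred nat)
    (N : nat) :
  (forall n, 0 <= g n) -> uniq s -> (forall n, n \in s -> (n < N)%N && P n) ->
  \sum_(n <- s) g n <= \sum_(n < N | P n) g n.
Proof.
move=> g0 us sP; rewrite -(big_mkord P g) -big_filter.
rewrite [leRHS](bigID (fun n => n \in s)) /=.
have -> : \sum_(i <- [seq i <- index_iota 0 N | P i] | i \in s) g i
    = \sum_(n <- s) g n.
  rewrite -big_filter; apply: perm_big; apply: uniq_perm => //.
    by rewrite !filter_uniq // iota_uniq.
  move=> n; rewrite !mem_filter mem_index_iota /=.
  by case: (boolP (n \in s)) => // /sP /andP[-> ->].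
by rewrite lerDl sumr_ge0.
Qed.

(** Induction on a bound for the lengths. A list containing the empty string contains nothing else;
    otherwise it splits by first bit, and deleting that bit leaves two prefix-free lists, each
    contributing half of a sum that is at most 1. *)
Lemma kraft_seq (F : realFieldType) (l : seq bitseq) :
  uniq l -> {in l &, forall p q, prefix p q -> p = q} ->
  \sum_(p <- l) weight F (size p) <= 1.
Proof.
have [N] : exists N, all (fun p : bitseq => (size p <= N)%N) l.
  exists (\max_(p <- l) size p)%N; apply/allP => p pl.
  by rewrite (big_rem p) //= leq_maxl.
elim: N l => [|N IH] l /allP lN ul pf; case: (boolP ([::] \in l)) => [l0|l0].
1,3: suff -> : l = [:: [::]] by rewrite big_seq1.
1,2: apply: perm_small_eq => //; apply: uniq_perm => // p; rewrite inE.
1,2: by apply/idP/eqP => [pl|-> //]; rewrite -(pf [::] p) // prefix0s.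
- rewrite big_seq big1 ?ler01 // => p pl; move: (lN _ pl); rewrite leqn0 size_eq0.
  by move=> /eqP p0; rewrite p0 (negbTE l0) in pl.
pose lb b := [seq behead p | p <- l & ohead p == Some b].
have half b : \sum_(p <- lb b) weight F (size p) <= 1.
  have inj : {in [seq p <- l | ohead p == Some b], forall p, p = b :: behead p}.
    by move=> [|c p]; rewrite mem_filter //= => /andP[/eqP[->]].
  apply: IH.
  - apply/allP => p /mapP[q ql ->]; have e := inj _ ql.
    by move: ql; rewrite mem_filter => /andP[_ /lN]; rewrite e.
  - rewrite map_inj_in_uniq ?filter_uniq // => p q pl ql e.
    by rewrite (inj p) // (inj q) // e.
  - move=> p q /mapP[p' pl ->] /mapP[q' ql ->] pq.
    suff -> : p' = q' by [].
    apply: pf; [by move: pl; rewrite mem_filter => /andP[]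
      |by move: ql; rewrite mem_filter => /andP[]|].
    by rewrite (inj p') // (inj q') //= eqxx.
suff -> : \sum_(p <- l) weight F (size p) =
    2%:R^-1 * \sum_(p <- lb true) weight F (size p) +
    2%:R^-1 * \sum_(p <- lb false) weight F (size p).
  have := half true; have := half false; lra.
rewrite !big_map !big_filter !mulr_sumr (bigID (fun p => ohead p == Some true)) /=.
congr (_ + _).
  by apply: eq_bigr => -[|b p] //= _; rewrite /weight exprS.
rewrite big_seq_cond [RHS]big_seq_cond; apply: eq_big => [[|b p]|[|b p]] /=.
- by rewrite (negbTE l0).
- by case: b; rewrite ?andbF.
- by rewrite (negbTE l0).
- by rewrite /weight exprS.
Qed.

Lemma kraft (F : realFieldType) (D : pred nat) (N : nat) :
  (forall m n, D m -> D n -> prefix (decode m) (decode n) -> m = n) ->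
  \sum_(n < N | D n) weight F (slen n) <= 1.
Proof.
move=> pf; rewrite -(big_mkord D (fun n => weight F (slen n))) -big_filter.
have -> : \sum_(i <- [seq i <- index_iota 0 N | D i]) weight F (slen i) =
    \sum_(p <- map decode [seq i <- index_iota 0 N | D i]) weight F (size p).
  by rewrite big_map; apply: eq_bigr => n _; rewrite size_mkseq.
apply: kraft_seq.
  by rewrite (map_inj_uniq (can_inj decodeK)) filter_uniq // iota_uniq.
move=> p q /mapP[m + ->] /mapP[n + ->]; rewrite !mem_filter.
by move=> /andP[Dm _] /andP[Dn _] /pf ->.
Qed.

Fixpoint msb (s : bitseq) : nat :=
  if s is b :: s' then (b * 2 ^ size s' + msb s')%N else 0%N.

Lemma msb_lt s : (msb s < 2 ^ size s)%N.
Proof. by elim: s => //= b s; rewrite expnS; case: b; lia. Qed.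

Lemma msb_cat s t : msb (s ++ t) = (msb s * 2 ^ size t + msb t)%N.
Proof.
elim: s => //= b s ->; rewrite size_cat expnD mulnDl; lia.
Qed.

Lemma msb_surj L v : (v < 2 ^ L)%N -> exists2 s, size s = L & msb s = v.
Proof.
elim: L v => [|L IH] v; first by rewrite expn0 ltnS leqn0 => /eqP ->; exists [::].
rewrite expnS => lt; case: (ltnP v (2 ^ L)) => h.
  by have [s <- <-] := IH _ h; exists (false :: s).
have [|s sL sv] := IH (v - 2 ^ L)%N; first lia.
exists (true :: s) => /=; first by rewrite sL.
by rewrite sL sv; lia.
Qed.

Lemma smsbE s : smsb (str_code s) = msb s.
Proof.
rewrite /smsb /nsum slen_code.
rewrite (eq_bigr (fun i : 'I__ => nth false s i * 2 ^ (size s - i.+1))%N); last first.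
  by move=> i _; rewrite sbit_code.
elim: s => [|b s IH] /=; first by rewrite big_ord0.
by rewrite big_ord_recl /= subSS subn0 -IH.
Qed.

(** * The Kraft-Chaitin theorem *)

Local Open Scope ring_scope.

Local Open Scope nat_scope.

(** The index [i] codes a stage and a request. Only the first stage of a request counts, so its
    weight is spent once. *)
Definition fresh (req : nat -> nat -> bool) (i : nat) : bool :=
  req (nfst i) (nsnd i) && (nsum (nfst i) (fun t => req t (nsnd i)) == 0).

(** [2 ^ scale l i] is a common denominator for the weights of all requests up to index [i], with
    room for halving them. *)
Definition scale (l : nat -> nat) (i : nat) : nat :=
  (nsum i.+1 (fun j => l (nsnd j))).+1.

(* Request [i] owns an interval of length [2 ^- l] starting at the sum of the
   weights of the earlier ones.  It contains an aligned dyadic interval of half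
   that length; [codeword] is its left end times [2 ^ l.+1], a rounded up
   quotient. *)
Definition codeword req l (i : nat) : nat :=
  (nsum i (fun j => fresh req j * 2 ^ (scale l i - l (nsnd j)))
   + 2 ^ (scale l i - (l (nsnd i)).+1) - 1)
  %/ 2 ^ (scale l i - (l (nsnd i)).+1).

Definition serves req l (n i : nat) : bool :=
  [&& fresh req i, (l (nsnd i)).+1 == slen n & codeword req l i == smsb n].

Lemma decidable_serves req l :
  decidable_set (fun w => req (nfst w) (nsnd w)) -> computable l ->
  decidable_set (fun w => serves req l (nfst w) (nsnd w)).
Proof.
move=> RC lC.
have freshC f : computable f -> decidable_set (fun w => fresh req (f w)).
  by move=> fC; rewrite /fresh; comp.
have scaleC f : computable f -> computable (fun w => scale l (f w)).
  by move=> fC; rewrite /scale; comp.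
rewrite /serves /codeword.
comp.
Qed.

Local Open Scope ring_scope.

(** The left end of the interval owned by a fresh index [i]; its right end is the value at
    [i.+1]. *)
Definition served (F : realFieldType) req l (i : nat) : F :=
  \sum_(j < i | fresh req j) weight F (l (nsnd j)).

Lemma served_le F req l i j : (i <= j)%N -> served F req l i <= served F req l j.
Proof.
move=> le; rewrite /served -!(big_mkord (fresh req) (fun j => weight F (l (nsnd j)))).
rewrite [leRHS](@big_cat_nat _ _ _ i) //= lerDl.
by apply: sumr_ge0 => k _.
Qed.

Lemma servedS F req l i : fresh req i ->
  served F req l i.+1 = served F req l i + weight F (l (nsnd i)).
Proof. by move=> fi; rewrite /served [LHS]big_mkcond big_ord_recr /= fi -big_mkcond. Qed.

(** The owned interval is two units of length [2^-(l+1)] long, and rounding its left end up to a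
    multiple of the unit loses less than one of them. *)
Lemma codeword_bounds F req l i : fresh req i ->
  served F req l i <= (codeword req l i)%:R * weight F (l (nsnd i)).+1 /\
  ((codeword req l i).+1)%:R * weight F (l (nsnd i)).+1 < served F req l i.+1.
Proof.
move=> fi; rewrite servedS // -(weightS F (l (nsnd i))).
have lsc j : (j <= i)%N -> (l (nsnd j) < scale l i)%N.
  move=> le; rewrite /scale ltnS /nsum.
  by rewrite (bigD1 (Ordinal (le : j < i.+1)%N)) //= leq_addr.
set L := (l (nsnd i)).+1; set B := scale l i.
have LB : (L <= B)%N by apply: lsc.
have numE : (nsum i (fun j => fresh req j * 2 ^ (B - l (nsnd j)))%N)%:R * weight F B
    = served F req l i.
  rewrite /nsum natr_sum mulr_suml /served [RHS]big_mkcond /=.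
  apply: eq_bigr => j _; case: (fresh req j); rewrite ?mul0n ?mul0r //.
  by rewrite mul1n weight_sub // ltnW // lsc // ltnW.
rewrite /codeword -/L -/B -numE.
move: (nsum _ _) => N.
have D0 : (0 < 2 ^ (B - L))%N by rewrite expn_gt0.
have e := weight_sub F LB.
set D := (2 ^ (B - L))%N in D0 e *.
set q := ((N + D - 1) %/ D)%N.
have q1 : (N <= q * D)%N.
  have := divn_eq (N + D - 1) D; have := ltn_pmod (N + D - 1) D0.
  rewrite -/q; lia.
have q2 : (q * D < N + D)%N.
  have := leq_trunc_div (N + D - 1) D; rewrite -/q; lia.
rewrite -e; split.
  rewrite mulrA -natrM ler_pM2r //. by rewrite ler_nat.
rewrite !mulrA -natrM -!mulrDl ltr_pM2r // -!natrD ltr_nat; lia.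
Qed.

(** If [q] extends [p], its dyadic interval lies inside that of [p]; but intervals owned by
    different indices do not overlap. *)
Lemma serves_inj req l p q i j :
  serves req l (str_code p) i -> serves req l (str_code q) j -> prefix p q -> i = j.
Proof.
rewrite /serves !slen_code !smsbE.
move=> /and3P[fi /eqP Li /eqP ci] /and3P[fj /eqP Lj /eqP cj].
have [loi hii] := codeword_bounds rat l fi.
have [loj hij] := codeword_bounds rat l fj.
rewrite Li ci in loi hii; rewrite Lj cj in loj hij.
move=> /prefixP[r qE]; move: loj hij; rewrite qE msb_cat size_cat weightD => loj hij.
have lr := msb_lt r.
have e := weight_exp rat (size r).
have a : (msb p * 2 ^ size r + msb r)%:R * (weight rat (size p) * weight rat (size r)) <
   (msb p).+1%:R * weight rat (size p).
  have -> : (msb p).+1%:R * weight rat (size p) = ((msb p).+1 * 2 ^ size r)%:R *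
     (weight rat (size p) * weight rat (size r)).
    by rewrite natrM -!mulrA (mulrCA (_ ^ _)%:R) e mulr1.
  by rewrite ltr_pM2r ?mulr_gt0 // ltr_nat mulSn addnC ltn_add2r.
have b : (msb p)%:R * weight rat (size p) <
    (msb p * 2 ^ size r + msb r).+1%:R * (weight rat (size p) * weight rat (size r)).
  have -> : (msb p)%:R * weight rat (size p) = (msb p * 2 ^ size r)%:R *
     (weight rat (size p) * weight rat (size r)).
    by rewrite natrM -!mulrA (mulrCA (_ ^ _)%:R) e mulr1.
  by rewrite ltr_pM2r ?mulr_gt0 // ltr_nat ltnS leq_addr.
case: (ltngtP i j) => // lt.
- have := lt_trans (lt_le_trans hii (le_trans (served_le rat req l lt) loj)) a.
  by rewrite ltxx.
- have := lt_trans b (lt_le_trans hij (le_trans (served_le rat req l lt) loi)).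
  by rewrite ltxx.
Qed.

(** The machine searches for the index served by its input and outputs the value attached to that
    request. The weight condition concerns finitely many requests made by a common stage [S], so it
    can be verified on the approximation at [S]. *)
Theorem kraft_chaitin (F : realFieldType) (U : program)
    (req : nat -> nat -> bool) (l x : nat -> nat) :
  universal_prefix_free_machine U ->
  decidable_set (fun w => req (nfst w) (nsnd w)) -> computable l -> computable x ->
  (forall S (s : seq nat), uniq s ->
     (forall z, z \in s -> exists2 t, (t <= S)%N & req t z) ->
     \sum_(z <- s) weight F (l z) <= 1) ->
  exists c, forall A t z, req t z ->
    exists2 p, size p = (l z + c)%N & machine U A p (x z).
Proof.
move=> [Upf Uuniv] RC lC xC sum1.
have [ct ctP] := decidable_not (decidable_serves RC lC).
have [cx cxP] := computable_comp xC computable_snd_id.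
have mP A p n : machine (PComp cx (PMu ct)) A p n <-> exists i,
    [/\ serves req l (str_code p) i, n = x (nsnd i) &
      forall m, (m < i)%N -> ~~ serves req l (str_code p) m].
  rewrite /machine /=; split.
    case=> i [/ctP + lt] /cxP ->; rewrite !nprE => e; exists i; split=> //.
      by move: e; case: (serves _ _ _ _).
    by move=> m /lt[k /ctP]; rewrite !nprE; case: (serves _ _ _ _).
  case=> i [e -> lt]; exists i; last exact/cxP.
  split; first by apply/ctP; rewrite !nprE e.
  by move=> m /lt h; exists 0%N; apply/ctP; rewrite !nprE h.
have pf : prefix_free_machine (PComp cx (PMu ct)).
  move=> A p q m n /mP[i [pi _ _]] /mP[j [qj _ _]] pq.
  have ij := serves_inj pi qj pq; rewrite -{}ij in qj.
  have /and3P[_ /eqP sp _] := pi; have /and3P[_ /eqP sq _] := qj.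
  rewrite !slen_code in sp sq.
  by move: pq; rewrite prefixE -sp sq take_size => /eqP.
have [r rP] := Uuniv _ pf.
(* One bit is lost by rounding to a dyadic interval; [r] is the prefix by which [U] simulates the
   machine. *)
exists (size r).+1 => A t z Rtz.
have exR : exists t, req t z by exists t.
case: (ex_minnP exR) => t0 Rt0 min_t0.
pose i := npair t0 z.
have fi : fresh req i.
  rewrite /fresh !nprE Rt0 /= /nsum sum_nat_eq0; apply/forallP => j.
  rewrite /= eqb0; apply/negP => /min_t0; rewrite leqNgt; case: j => j /= lt.
  by rewrite lt.
have [_ hi] := codeword_bounds F l fi.
have S1 : served F req l i.+1 <= 1.
  rewrite /served -(big_mkord (fresh req) (fun j => weight F (l (nsnd j)))) -big_filter.
  rewrite -(big_map nsnd xpredT (fun z => weight F (l z))).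
  (* A request is fresh at one index only, and a stage is at most the index coding it, so all
     requests counted here were made by stage [i]. *)
  apply: (sum1 i).
    rewrite map_inj_in_uniq ?filter_uniq ?iota_uniq // => a b.
    rewrite !mem_filter => /andP[+ _] /andP[+ _] e.
    rewrite /fresh -e => /andP[Ra a0] /andP[Rb b0].
    rewrite -[a]npairK -[b]npairK -e; congr npair.
    have le u v : nsum v (fun t => req t (nsnd a)) == 0%N ->
        req u (nsnd a) -> (v <= u)%N.
      rewrite /nsum sum_nat_eq0 leqNgt => /forallP h Ru; apply/negP => lt.
      by have := h (Ordinal lt); rewrite /= Ru.
    by apply/eqP; rewrite eqn_leq !le.
  move=> y /mapP[j]; rewrite mem_filter mem_index_iota => /andP[/andP[Rj _] lt] ->.
  by exists (nfst j) => //; apply: leq_trans (nfst_le j) _.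
have [p sp mp] : exists2 p, size p = (l z).+1 & msb p = codeword req l i.
  apply: msb_surj; rewrite -(ltr_nat F) -(ltr_pM2r (weight_gt0 F (l z).+1)) weight_exp.
  rewrite nprE in hi; apply: le_lt_trans (lt_le_trans hi S1).
  by rewrite ler_pM2r // ler_nat.
have pi : serves req l (str_code p) i.
  by rewrite /serves fi slen_code smsbE sp mp nprE !eqxx.
exists (r ++ p); first by rewrite size_cat sp; lia.
apply/rP/mP.
exists i; split=> //; first by rewrite nprE.
move=> m lt; apply/negP => pm.
by move: lt; rewrite (serves_inj pm pi (prefix_refl _)) ltnn.
Qed.

(** * Complexity and the coding theorem *)

Local Open Scope ring_scope.

(** The series telescopes, since [weight F l.+1] is the difference of [weight F l] and
    [weight F l.+1]. *)
Lemma sum_weight_tail (F : realFieldType) l0 N :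
  \sum_(l < N | (l0 <= l)%N) weight F l.+1 <= weight F l0.
Proof.
suff h : \sum_(l < N | (l0 <= l)%N) weight F l.+1 <= weight F l0 - weight F (maxn l0 N).
  by apply: le_trans h _; rewrite lerBlDr lerDl.
elim: N => [|N IH]; first by rewrite big_ord0 maxn0 subrr.
rewrite big_mkcond big_ord_recr -big_mkcond /=.
case: (leqP l0 N) IH => [le|lt].
  rewrite (maxn_idPr (leqW le)) => IH.
  by have := weightS F N; lra.
by rewrite addr0 (maxn_idPl lt).
Qed.

Lemma sum_by_key_le (F : realFieldType) (I : Type) (r : seq I) (P : pred I)
    (k : I -> nat) (g : I -> F) N : (forall i, 0 <= g i) ->
  \sum_(x < N) \sum_(i <- r | P i && (k i == x)) g i <= \sum_(i <- r | P i) g i.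
Proof.
move=> g0; rewrite (exchange_big_dep P) /=; last by move=> x i _ /andP[].
apply: ler_sum => i Pi; case: (ltnP (k i) N) => [lt|le].
  rewrite (eq_bigl (pred1 (Ordinal lt))) ?big_pred1_eq // => x.
  by rewrite Pi /= eq_sym -val_eqE.
rewrite big1 // => x /andP[_ /eqP e]; have := ltn_ord x.
by rewrite -e ltnNge le.
Qed.

Lemma sum_by_key (F : realFieldType) (I : eqType) (r : seq I) (P : pred I)
    (k : I -> nat) (g : I -> F) N : (forall i, i \in r -> (k i < N)%N) ->
  \sum_(i <- r | P i) g i = \sum_(x < N) \sum_(i <- r | P i && (k i == x)) g i.
Proof.
move=> kN; rewrite (exchange_big_dep P) /=; last by move=> x i _ /andP[].
rewrite big_seq_cond [RHS]big_seq_cond; apply: eq_bigr => i /andP[/kN lt Pi].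
rewrite (eq_bigl (pred1 (Ordinal lt))) ?big_pred1_eq // => x.
by rewrite Pi /= eq_sym -val_eqE.
Qed.

(** Programs that halt on the finite oracle [h] all halt on the full oracle [oracle_of h], where [U]
    is prefix-free. *)
Lemma domain_kraft (F : realFieldType) U h N : prefix_free_machine U ->
  \sum_(n < N | (0 < eval_fin U h n)%N) weight F (slen n) <= 1.
Proof.
move=> pf; apply: (@kraft F (fun n => 0 < eval_fin U h n)%N) => m n.
case em: (eval_fin U h m) => [|u] // _; case en: (eval_fin U h n) => [|v] // _.
move/(eval_fin_sound (@agree_oracle_of h)): em => em.
move/(eval_fin_sound (@agree_oracle_of h)): en => en.
move=> /(pf (oracle_of h) (decode m) (decode n) u v); rewrite /machine !decodeK.
by move=> /(_ em en) /(can_inj decodeK).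
Qed.

Lemma eventually_all (T : eqType) (s : seq T) (P : T -> nat -> Prop) :
  (forall z, z \in s -> exists n, forall m, (n <= m)%N -> P z m) ->
  exists n, forall m, (n <= m)%N -> forall z, z \in s -> P z m.
Proof.
elim: s => [|z s IH] h; first by exists 0%N.
have [z' z's|n1 h1] := IH; first by apply: h; rewrite inE z's orbT.
have [|n2 h2] := h z; first by rewrite inE eqxx.
exists (maxn n1 n2) => m; rewrite geq_max => /andP[le1 le2] z'.
by rewrite inE => /predU1P[->|]; [exact: h2|exact: h1].
Qed.

Section Complexity.
Context (U : program) (hU : universal_prefix_free_machine U).

Lemma complexityP A n : is_complexity U A n (complexity U A n).
Proof.
suff [p pn] : exists p, machine U A p n.
  have ex : exists k, [exists p : k.-tuple bool, `[< machine U A p n >]].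
    exists (size p); apply/existsP; exists (in_tuple p); exact/asboolP.
  apply: (@xgetPex _ 0%N [set k | is_complexity U A n k]).
  case: (ex_minnP ex) => k /existsP[q /asboolP qn] kmin; exists k; split.
    by exists q => //; rewrite size_tuple.
  move=> q' q'n; apply: kmin; apply/existsP; exists (in_tuple q'); exact/asboolP.
(* Requesting each [n] at length [n + 1] makes every number an output of [U] under every oracle. *)
have [||||c] := @kraft_chaitin rat U (fun _ _ => true) succn id hU.
- exact: computable_const.
- exact: computable_succ computable_id.
- exact: computable_id.
- move=> _ s us _.
  apply: (@le_trans _ _ (\sum_(l < \max_(z <- s) z.+1 | (0 <= l)%N) weight rat l.+1)).
    apply: (@ler_sum_sub rat (fun n => weight rat n.+1)) => // z zs; rewrite andbT.
    by rewrite (big_rem z) //= leq_max leqnn.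
  exact: sum_weight_tail.
- by move=> /(_ A 0%N n isT)[p _ pn]; exists p.
Qed.

Lemma complexity_le A p n : machine U A p n -> (complexity U A n <= size p)%N.
Proof. by case: (complexityP A n) => _; exact. Qed.

Lemma complexity_witness A n :
  exists2 p, size p = complexity U A n & machine U A p n.
Proof. by case: (complexityP A n). Qed.

(** Answers every oracle query by 0. As [U] simulates [strip U], an oracle can raise complexity by a
    constant at most. *)
Fixpoint strip (c : program) : program :=
  match c with
  | POracle => PZero
  | PPair f g => PPair (strip f) (strip g)
  | PComp f g => PComp (strip f) (strip g)
  | PRec f g => PRec (strip f) (strip g)
  | PMu f => PMu (strip f)
  | c => c
  end.

Lemma prim_rec_ext (F F' G G' : nat -> nat -> Prop) a n y :
  (forall x y, F x y <-> F' x y) -> (forall x y, G x y <-> G' x y) ->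
  prim_rec F G a n y <-> prim_rec F' G' a n y.
Proof.
move=> eF eG; elim: n y => [|n IH] y //=.
by split=> -[r /IH ? /eG ?]; exists r.
Qed.

Lemma peval_strip A c x y : peval A (strip c) x y <-> peval empty_oracle c x y.
Proof.
elim: c x y => [|||||f IHf g IHg|f IHf g IHg|f IHf g IHg|f IHf] x y //=.
- by split=> -[u [v [/IHf ? /IHg ? ?]]]; exists u, v.
- by split=> -[u /IHg ? /IHf ?]; exists u.
- exact: prim_rec_ext.
- split=> -[/IHf ? h]; split=> // m /h[k /IHf ?]; by exists k.
Qed.

Lemma complexity_relativize :
  exists c, forall A n, (complexity U A n <= complexity U empty_oracle n + c)%N.
Proof.
have [Upf Uu] := hU.
have pf : prefix_free_machine (strip U).
  by move=> A p q m n /peval_strip pm /peval_strip qn; exact: Upf pm qn.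
have [r rP] := Uu _ pf; exists (size r) => A n.
have [p <- pn] := complexity_witness empty_oracle n.
rewrite addnC -size_cat; apply: complexity_le; apply/rP; exact/peval_strip.
Qed.

(** The code of the string of [s] zeros, an initial segment of the empty oracle; [s] also acts as
    the stage of the approximation. *)
Definition zeros (s : nat) : nat := (2 ^ s - 1)%N.

Lemma slen_zeros s : slen (zeros s) = s.
Proof.
apply: slen_uniq; rewrite /zeros subn1 prednK ?expn_gt0 // leqnn.
by rewrite /= ltn_exp2l ?ltnSn.
Qed.

Lemma agree_zeros s : agree (zeros s) empty_oracle.
Proof.
move=> i; rewrite slen_zeros => lt; rewrite /sbit /zeros subn1 prednK ?expn_gt0 //.
rewrite -{1}(subnK (ltnW lt)) expnD mulnK ?expn_gt0 // oddX.
by rewrite orbF subn_eq0 leqNgt lt.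
Qed.

Definition outputs (f : nat -> nat) (s x n : nat) : bool :=
  (0 < eval_fin U (zeros s) n)%N && (f (eval_fin U (zeros s) n).-1 == x).

(** For [z] coding [(x, l)], this is the inequality of [probableE] cleared of denominators, hence
    decidable. *)
Definition probable (f : nat -> nat) (s z : nat) : bool :=
  (2 ^ s <= 2 ^ nsnd z *
    nsum s (fun n => outputs f s (nfst z) n * 2 ^ (s - slen n)))%N.

Lemma probableE (F : realFieldType) f s z : probable f s z =
  (weight F (nsnd z) <= \sum_(n < s | outputs f s (nfst z) n) weight F (slen n)).
Proof.
rewrite /probable -(ler_nat F) -(ler_pM2r (weight_gt0 F s)) weight_exp natrM -mulrA.
rewrite -(ler_pM2l (weight_gt0 F (nsnd z))) mulr1 !mulrA.
rewrite (mulrC (weight F _)) weight_exp mul1r.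
congr (_ <= _); rewrite /nsum natr_sum mulr_suml [RHS]big_mkcond.
apply: eq_bigr => n _; case: (outputs _ _ _ _); last by rewrite mul0n mul0r.
by rewrite mul1n weight_sub // (leq_trans (slen_le n)) // ltnW.
Qed.

Lemma outputs_mono f s t x n : (s <= t)%N -> outputs f s x n -> outputs f t x n.
Proof.
move=> st; rewrite /outputs; case e: (eval_fin U (zeros s) n) => [|y] //=.
rewrite (@eval_fin_pre _ _ (zeros t) _ _ _ e) //.
by apply: (agree_pre (@agree_zeros s) (@agree_zeros t)); rewrite !slen_zeros.
Qed.

Lemma probable_mono f s t z : (s <= t)%N -> probable f s z -> probable f t z.
Proof.
move=> st; rewrite !(probableE rat) => /le_trans; apply.
pose g n := weight rat (slen n).
rewrite -(big_mkord (outputs f s (nfst z)) g) -big_filter.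
apply: (@ler_sum_sub rat g) => [n||n]; rewrite ?filter_uniq ?iota_uniq //.
  exact: weight_ge0.
rewrite mem_filter mem_index_iota => /andP[on lt].
by rewrite (leq_trans lt st) (outputs_mono st on).
Qed.

(** The value [x] is requested at length [l + 1] once programs whose output [f] maps to [x] are seen
    to weigh at least [2^-l]. For one [x] these requests form a geometric series bounded by that
    weight, and Kraft's inequality bounds the sum over [x]. *)
Theorem coding_theorem (F : realFieldType) (f : nat -> nat) : computable f ->
  exists c, forall x (s : seq nat), uniq s -> (forall n, n \in s -> f n = x) ->
    \sum_(n <- s) weight F (complexity U empty_oracle n) <=
    2%:R ^+ c * weight F (complexity U empty_oracle x).
Proof.
move=> fC; have [Upf _] := hU.
have [||||c cP] := @kraft_chaitin F U (probable f) (fun z => (nsnd z).+1) nfst hU.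
- by rewrite /probable /outputs /zeros; comp.
- by comp.
- by comp.
- move=> S s us sR.
  have {}sR z : z \in s -> weight F (nsnd z) <=
      \sum_(n < S | outputs f S (nfst z) n) weight F (slen n).
    by move=> /sR[t le]; rewrite -probableE; exact: probable_mono.
  pose N := \max_(z <- s) (nfst z).+1.
  have sN z : z \in s -> (nfst z < N)%N.
    by move=> zs; rewrite /N (big_rem z) //= leq_max leqnn.
  rewrite (sum_by_key _ _ sN) /=.
  apply: le_trans (domain_kraft F (zeros S) S Upf).
  apply: le_trans (@sum_by_key_le F _ _ _ (fun n : 'I_S => f (eval_fin U (zeros S) n).-1)
     _ N _); last by [].
  apply: ler_sum => x _; rewrite -/(outputs f S x _).
  set mu := (X in _ <= X).
  have mu0 : 0 <= mu by apply: sumr_ge0.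
  have sx z : z \in s -> nfst z == x -> weight F (nsnd z) <= mu.
    by move=> zs /eqP zx; rewrite (le_trans (sR z zs)) // zx.
  (* Without such an [l], as for [mu = 0], nothing is requested for [x]; otherwise every requested
     [l] is at least the least one. *)
  case: (pselect (exists l, weight F l <= mu)) => [ex|nex]; last first.
    rewrite big_seq_cond big1 // => z /andP[zs /(sx z zs) le].
    by case: nex; exists (nsnd z).
  case: (ex_minnP ex) => l0 le0 lmin.
  pose M := \max_(z <- s) (nsnd z).+1.
  apply: le_trans le0; apply: le_trans (sum_weight_tail F l0 M).
  rewrite -big_filter -(big_map nsnd xpredT (fun l => weight F l.+1)).
  apply: (@ler_sum_sub F (fun l => weight F l.+1)) => //.
    rewrite map_inj_in_uniq ?filter_uniq // => y z.
    rewrite !mem_filter => /andP[/eqP yx _] /andP[/eqP zx _] e.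
    by rewrite -[y]npairK -[z]npairK yx zx e.
  move=> l /mapP[z]; rewrite mem_filter => /andP[zx zs] ->.
  by rewrite lmin ?sx // andbT /M (big_rem z) //= leq_max leqnn.
(* One extra bit comes from the request length [l + 1], the other from rounding [T] down to a power
   of 2. *)
exists (c + 2)%N => x s us sx.
have [q qP] := @boolp.choice _ _ (fun n p =>
    size p = complexity U empty_oracle n /\ machine U empty_oracle p n)
    (fun n => let: ex_intro2 p pn mp := complexity_witness empty_oracle n in
      ex_intro _ p (conj pn mp)).
have [S hS] : exists S, forall m, (S <= m)%N -> forall n, n \in s ->
    (str_code (q n) < m)%N && (eval_fin U (zeros m) (str_code (q n)) == n.+1).
  apply: eventually_all => n ns; have [_ /eval_fin_complete[k kP]] := qP n.
  exists (maxn k (str_code (q n)).+1) => m; rewrite geq_max => /andP[km ->].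
  by rewrite kP ?slen_zeros //=; exact: agree_zeros.
set T := \sum_(n <- s) _.
have T_le : T <= \sum_(m < S | outputs f S x m) weight F (slen m).
  rewrite /T (eq_bigr (fun n => weight F (slen (str_code (q n))))); last first.
    by move=> n _; rewrite slen_code (qP n).1.
  rewrite -(big_map (str_code \o q) xpredT (fun m => weight F (slen m))).
  apply: (@ler_sum_sub F (fun m => weight F (slen m))) => //.
    rewrite map_inj_in_uniq // => m n _ _ /(can_inj str_codeK) e.
    apply: (peval_inj (qP m).2); rewrite e; exact: (qP n).2.
  move=> _ /mapP[n ns ->] /=; have /andP[-> /eqP e] := hS S (leqnn S) n ns.
  by rewrite /outputs e /= sx.
(* Needed for [l0 = 0], where minimality of [l0] gives no upper bound on [T]. *)
have T_le1 : T <= 1.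
  apply: le_trans T_le _; apply: le_trans (domain_kraft F (zeros S) S Upf).
  pose g m := weight F (slen m).
  rewrite -(big_mkord (outputs f S x) g) -big_filter.
  apply: (@ler_sum_sub F g _ (fun n => (0 < eval_fin U (zeros S) n)%N) S)
    => [n||n]; rewrite ?filter_uniq ?iota_uniq //.
    exact: weight_ge0.
  by rewrite mem_filter mem_index_iota => /andP[/andP[-> _] /= ->].
case: s us sx @T T_le T_le1 hS => [|n0 s] us sx T T_le T_le1 hS.
  by rewrite /T big_nil mulr_ge0 ?exprn_ge0 ?ler0n.
have ex : exists l, weight F l <= T.
  exists (complexity U empty_oracle n0); rewrite /T big_cons lerDl.
  by apply: sumr_ge0.
case: (ex_minnP ex) => l0 le0 lmin.
have T2 : T <= 2%:R * weight F l0.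
  case: l0 le0 lmin => [|l0] le0 lmin.
    by rewrite /weight expr0 mulr1 (le_trans T_le1) // ler1n.
  rewrite mulr_natl mulr2n weightS leNgt; apply/negP => /ltW /lmin.
  by rewrite ltnn.
have [|p sp pn] := cP empty_oracle S (npair x l0).
  by rewrite (probableE F) !nprE (le_trans le0).
rewrite !nprE in sp pn.
have := complexity_le pn; rewrite sp -(weight_le F) => Kx.
apply: le_trans T2 _; apply: le_trans (ler_wpM2l _ Kx); last first.
  by rewrite exprn_ge0 // ler0n.
rewrite addSn -addnS weightD mulrCA (_ : 2%:R ^+ _ * weight F c.+1 = 2%:R) //.
  by rewrite mulrC.
by rewrite addn2 exprS -mulrA -natrX weight_exp mulr1.
Qed.

End Complexity.

(** * Approximating the tree *)

Local Open Scope nat_scope.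

Lemma sum_by_seq_le (F : realFieldType) (I T : eqType) (r : seq I) (V : seq T)
    (k : I -> T) (g : I -> F) : (forall i, 0 <= g i)%R ->
  (forall i, i \in r -> k i \in V) ->
  (\sum_(i <- r) g i <= \sum_(x <- V) \sum_(i <- r | k i == x) g i)%R.
Proof.
move=> g0 kV; rewrite (exchange_big_dep xpredT) //=.
rewrite big_seq [leRHS]big_seq; apply: ler_sum => i /kV kiV.
by rewrite (big_rem (k i)) //= eqxx lerDl; apply: sumr_ge0.
Qed.

Lemma size_undup_rcons (T : eqType) (l : seq T) (x : T) :
  size (undup (rcons l x)) <= (x \notin l) + size (undup l).
Proof.
case: (boolP (x \in l)) => [xl|nxl] /=; [rewrite add0n | rewrite add1n].
  apply: uniq_leq_size => [|y]; first exact: undup_uniq.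
  by rewrite !mem_undup mem_rcons inE => /predU1P[->|].
apply: (@uniq_leq_size _ _ (x :: undup l)) => [|y]; first exact: undup_uniq.
by rewrite mem_undup mem_rcons !inE mem_undup.
Qed.

Section Tree.
Context (U : program) (hU : universal_prefix_free_machine U).

(** The bound [n < slen h] leaves finitely many programs, and the set still grows along
    extensions. *)
Definition halts (h n : nat) : bool := (n < slen h) && (0 < eval_fin U h n).

Definition better (e h t : nat) : bool :=
  pre h t && (2 ^ slen t <= 2 ^ e *
    nsum (slen t) (fun n => (halts t n && ~~ halts h n) * 2 ^ (slen t - slen n))).

Definition best (r e s : nat) : nat :=
  nat_iter r (fun t cur => if better e cur t then t else cur) s.

(* [2 ^ log_values k] bounds the number of values a node of level [k] takes over
   all stages; [overhead] is then forced by [values_level_mass], and [precision]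
   by [sum_level_mass]. *)
Definition log_values (k : nat) : nat := nat_iter 0 (fun j n => 3 * n + 5 * j + 14) k.
Definition precision (j : nat) : nat := 5 * j + 13 + 2 * log_values j.
Definition overhead (k : nat) : nat := 2 * k + 4 + log_values k.-1.

(** All levels are computed at the same stage [s]; a change at one level restarts the levels above
    it. *)
Definition tree (Z : nat -> bool) (s k : nat) : nat :=
  nat_iter 0 (fun j cur => best (srcons cur (Z j)) (precision j) s) k.

Lemma decidable_halts f g : computable f -> computable g ->
  decidable_set (fun z => halts (f z) (g z)).
Proof. by move=> fC gC; rewrite /halts; comp. Qed.
#[local] Hint Resolve decidable_halts : comp.

Lemma decidable_better e f g : computable e -> computable f -> computable g ->
  decidable_set (fun z => better (e z) (f z) (g z)).
Proof. by move=> eC fC gC; rewrite /better; comp. Qed.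
#[local] Hint Resolve decidable_better : comp.

Lemma computable_best r e s : computable r -> computable e -> computable s ->
  computable (fun z => best (r z) (e z) (s z)).
Proof.
move=> rC eC sC; rewrite /best.
by apply: (@computable_iter _ _ (fun z t cur =>
  if better (e z) cur t then t else cur)); comp.
Qed.
#[local] Hint Resolve computable_best : comp.

Lemma computable_precision f : computable f -> computable (fun z => precision (f z)).
Proof.
suff nC : computable log_values by move=> fC; rewrite /precision; comp.
by apply: (@computable_iter _ _ (fun _ j n => 3 * n + 5 * j + 14)); comp.
Qed.

Lemma computable_overhead f : computable f -> computable (fun z => overhead (f z)).
Proof.
suff nC : computable log_values by move=> fC; rewrite /overhead; comp.
by apply: (@computable_iter _ _ (fun _ j n => 3 * n + 5 * j + 14)); comp.
Qed.
#[local] Hint Resolve computable_precision computable_overhead : comp.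

Lemma computable_tree a s k : computable a -> computable s -> computable k ->
  computable (fun z => tree (sbit (a z)) (s z) (k z)).
Proof.
move=> aC sC kC; rewrite /tree.
by apply: (@computable_iter _ _ (fun z j cur =>
  best (srcons cur (sbit (a z) j)) (precision j) (s z))); comp.
Qed.
#[local] Hint Resolve computable_tree : comp.

(* A request codes [(k, (a, (rho, (n, x))))]: along a branch with initial segment
   [a], whose node of level [k] has the value [rho], the program [n] with output
   [x] first halts at level [k.+1]. *)
Definition rq_k (z : nat) : nat := nfst z.
Definition rq_a (z : nat) : nat := nfst (nsnd z).
Definition rq_rho (z : nat) : nat := nfst (nsnd (nsnd z)).
Definition rq_n (z : nat) : nat := nfst (nsnd (nsnd (nsnd z))).
Definition rq_x (z : nat) : nat := nsnd (nsnd (nsnd (nsnd z))).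

(** The bound on [rq_a z] leaves [2 ^ (k + 2)] initial segments at level [k], and [eta < s] is what
    [tree_gain] needs to bound the gain up to [eta]. *)
Definition requested (s z : nat) : bool :=
  let eta := tree (sbit (rq_a z)) s (rq_k z).+1 in
  [&& rq_a z < 2 ^ (rq_k z).+2, tree (sbit (rq_a z)) s (rq_k z) == rq_rho z,
      eta < s, halts eta (rq_n z), ~~ halts (rq_rho z) (rq_n z)
    & eval_fin U eta (rq_n z) == (rq_x z).+1].

Lemma decidable_requested :
  decidable_set (fun w => requested (nfst w) (nsnd w)).
Proof.
by rewrite /requested /rq_a /rq_k /rq_rho /rq_n /rq_x; comp.
Qed.

Lemma halts_pre h t n : pre h t -> halts h n -> halts t n.
Proof.
move=> ht; have /preP[le _] := ht; rewrite /halts => /andP[lt].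
case e: (eval_fin U h n) => [|y] // _.
by rewrite (eval_fin_pre ht e) (leq_trans lt le).
Qed.

Local Open Scope ring_scope.

(** * Mass of a string and gain of an extension *)

Definition mass (F : realFieldType) (h : nat) : F :=
  \sum_(n < slen h | halts h n) weight F (slen n).

Definition gain (F : realFieldType) (h t : nat) : F :=
  \sum_(n < slen t | halts t n && ~~ halts h n) weight F (slen n).

Lemma mass_le1 F h : mass F h <= 1.
Proof.
apply: le_trans (domain_kraft F h (slen h) hU.1).
rewrite /mass big_mkcond [leRHS]big_mkcond; apply: ler_sum => n _.
rewrite /halts ltn_ord /=; case: ifP => //.
Qed.

Lemma mass_ge0 F h : 0 <= mass F h.
Proof. by apply: sumr_ge0. Qed.

Lemma gainE F h t : pre h t -> gain F h t = mass F t - mass F h.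
Proof.
move=> ht; have /preP[le _] := ht.
have -> : mass F h = \sum_(n < slen t | halts t n && halts h n) weight F (slen n).
  pose g n := weight F (slen n).
  rewrite /mass -(big_mkord (halts h) g).
  rewrite -(big_mkord (fun n => halts t n && halts h n) g).
  rewrite [RHS](@big_cat_nat _ _ _ (slen h)) //= [X in _ + X]big1_seq ?addr0.
    apply: eq_bigl => n; case hn: (halts h n); rewrite ?andbF //.
    by rewrite (halts_pre ht hn).
  move=> n /andP[/andP[_ /andP[lt _]]].
  by rewrite mem_index_iota leqNgt lt.
rewrite {1}/mass (bigID (fun n : 'I__ => halts h n)) /=.
by rewrite addrAC subrr add0r.
Qed.

Lemma mass_pre F h t : pre h t -> mass F h <= mass F t.
Proof.
move=> ht; rewrite -subr_ge0 -gainE //.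
by apply: sumr_ge0.
Qed.

Lemma betterE F e h t : better e h t = pre h t && (weight F e <= gain F h t).
Proof.
rewrite /better; congr (_ && _).
rewrite -(ler_nat F) -(ler_pM2r (weight_gt0 F (slen t))) weight_exp natrM -mulrA.
rewrite -(ler_pM2l (weight_gt0 F e)) mulr1 !mulrA.
rewrite (mulrC (weight F _)) weight_exp mul1r.
congr (_ <= _); rewrite /nsum natr_sum mulr_suml /gain [RHS]big_mkcond.
apply: eq_bigr => n _; case: (_ && _); last by rewrite mul0n mul0r.
by rewrite mul1n weight_sub // (leq_trans (slen_le n)) // ltnW.
Qed.

Lemma bestS r e s : best r e s.+1 =
  if better e (best r e s) s then s else best r e s.
Proof. by []. Qed.

Lemma best_pre r e s t : (s <= t)%N -> pre (best r e s) (best r e t).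
Proof.
move=> /subnK <-; elim: (t - s)%N => [|m IH]; first exact: pre_refl.
apply: (pre_trans IH); rewrite addSn bestS.
by case: ifP => [/andP[]//|_]; exact: pre_refl.
Qed.

Lemma best_jump F r e s t : (s <= t)%N -> best r e t = best r e s \/
  mass F (best r e s) + weight F e <= mass F (best r e t).
Proof.
move=> /subnK <-; elim: (t - s)%N => [|m IH]; first by left.
rewrite addSn bestS; case: ifP => // h; right.
have := h; rewrite (betterE F) => /andP[hp]; rewrite gainE // lerBrDl => le.
have := mass_pre F (best_pre r e (leq_addl m s)); lra.
Qed.

(** The candidate [t] is examined only at stage [t], but the value was then a prefix of the present
    one, so the gain was at least as large and [2^-e] would have sufficed. If [t] was accepted, the
    present value is [t] itself and the gain is 0. *)
Lemma best_max F r e s t : (t < s)%N -> pre (best r e s) t ->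
  gain F (best r e s) t < weight F e.
Proof.
move=> lt st; have p1 := best_pre r e lt.
have p0 := best_pre r e (ltnW lt).
have tt : pre (best r e t) t := pre_trans p0 st.
rewrite gainE //; move: p1; rewrite bestS (betterE F) tt /=.
case: ifP => [_ p1|/negbT]; last first.
  rewrite -ltNge gainE // => lt1 _; apply: le_lt_trans lt1.
  by rewrite lerD2l lerN2 mass_pre.
have /preP[le _] := p1; by rewrite (pre_eq st le) subrr.
Qed.

Lemma best_count r e S :
  (size (undup [seq best r e s | s <- iota 0 S.+1]) <= 2 ^ e + 1)%N.
Proof.
rewrite -(ler_nat rat) -(ler_pM2r (weight_gt0 rat e)) natrD mulrDl weight_exp mul1r.
(* The induction needs the mass of the current value in place of 1, because each new value raises it
   by [2^-e]. *)
apply: (@le_trans _ _ (mass rat (best r e S) + weight rat e)); last first.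
  by rewrite lerD2r mass_le1.
elim: S => [|S IH]; first by rewrite /= mul1r lerDr mass_ge0.
have -> : iota 0 S.+2 = rcons (iota 0 S.+1) S.+1.
  by rewrite -[S.+2]addn1 iotaD cats1.
rewrite map_rcons.
set l := map _ _ in IH *.
have le_size := size_undup_rcons l (best r e S.+1).
apply: (@le_trans _ _ (((best r e S.+1 \notin l) + size (undup l))%:R * weight rat e)).
  by rewrite ler_pM2r // ler_nat.
have [e1|h] := best_jump rat r e (leqnSn S).
  have -> : best r e S.+1 \in l by rewrite e1; apply: map_f; rewrite mem_iota ltnSn.
  by rewrite e1.
rewrite natrD mulrDl addrC; apply: lerD; first exact: le_trans IH h.
by case: (_ \notin _); rewrite ?mul1r ?mul0r.
Qed.

Lemma best_limit r e : exists s, forall t, (s <= t)%N -> best r e t = best r e s.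
Proof.
apply: contrapT => nl.
have h m : exists s, m%:R * weight rat e <= mass rat (best r e s).
  elim: m => [|m [s sm]]; first by exists 0%N; rewrite mul0r mass_ge0.
  apply: contrapT => nh; apply: nl; exists s => t st.
  case: (best_jump rat r e st) => // h; case: nh; exists t.
  apply: le_trans h; rewrite -natr1 mulrDl mul1r lerD2r //.
have [s] := h (2 ^ e + 1)%N; rewrite natrD mulrDl weight_exp mul1r => h1.
have := mass_le1 rat (best r e s); have := weight_gt0 rat e.
by move=> h2 h3; have := le_trans h1 h3; rewrite gerDl leNgt h2.
Qed.

(** * Values of the nodes over all stages and total weight of the requests *)

Lemma treeS Z s k :
  tree Z s k.+1 = best (srcons (tree Z s k) (Z k)) (precision k) s.
Proof. by []. Qed.

Lemma eq_tree Z Z' s k : (forall i, (i < k)%N -> Z i = Z' i) ->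
  tree Z s k = tree Z' s k.
Proof.
elim: k => [//|k IH] e; rewrite !treeS IH ?e // => i lt; apply: e.
exact: ltnW.
Qed.

Lemma tree_pre_srcons Z s k : pre (srcons (tree Z s k) (Z k)) (tree Z s k.+1).
Proof. exact: (best_pre _ _ (leq0n s)). Qed.

Lemma tree_pre Z s k : pre (tree Z s k) (tree Z s k.+1).
Proof. exact: pre_trans (pre_srcons _ _) (tree_pre_srcons Z s k). Qed.

(** Bounds the gain above a node of level [k]. The root is not extended by [best], so only Kraft's
    bound 1 is available there. *)
Definition level_mass (F : realFieldType) (k : nat) : F :=
  if k is k'.+1 then weight F (precision k') else 1.

Lemma tree_gain F Z s k t : (t < s)%N -> pre (tree Z s k) t ->
  gain F (tree Z s k) t <= level_mass F k.
Proof.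
case: k => [|k] lt st; last by apply/ltW/best_max.
by rewrite gainE // lerBlDr -[leLHS]addr0 lerD ?mass_le1 ?mass_ge0.
Qed.

(** Each level runs [best] over all stages from every listed value of the level below. The list may
    contain values that no single stage produces; only its size matters. *)
Fixpoint values (Z : nat -> bool) (S k : nat) : seq nat :=
  if k is j.+1 then
    flatten [seq undup [seq best (srcons r (Z j)) (precision j) s | s <- iota 0 S.+1]
            | r <- values Z S j]
  else [:: 0%N].

Lemma tree_values Z s S k : (s <= S)%N -> tree Z s k \in values Z S k.
Proof.
move=> sS; elim: k => [//|k IH]; apply/flattenP.
exists (undup
  [seq best (srcons (tree Z s k) (Z k)) (precision k) t | t <- iota 0 S.+1]).
  exact: (map_f (fun r =>
    undup [seq best (srcons r (Z k)) (precision k) t | t <- iota 0 S.+1])).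
by rewrite mem_undup treeS; apply: (map_f (best _ _)); rewrite mem_iota.
Qed.

Lemma size_valuesS Z S k :
  (size (values Z S k.+1) <= size (values Z S k) * (2 ^ precision k + 1))%N.
Proof.
rewrite /=; elim: (values Z S k) => [//|r V IH].
by rewrite /= size_cat mulSn leq_add // best_count.
Qed.

(** Accounts for the constants in [log_values]: [3 * n + 5 * j + 14] is
    [n + (5 * j + 13 + 2 * n) + 1]. *)
Lemma log_valuesS k : log_values k.+1 = (log_values k + precision k + 1)%N.
Proof. rewrite /precision [LHS]/=; rewrite -/(log_values k); lia. Qed.

Lemma size_values Z S k : (size (values Z S k) <= 2 ^ log_values k)%N.
Proof.
elim: k => [//|k IH]; apply: leq_trans (size_valuesS Z S k) _.
rewrite log_valuesS -addnA expnD leq_mul // !addn1 expnS.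
have := expn_gt0 2 (precision k); lia.
Qed.

(* The factor [2 ^ precision k] in the number of values at level [k.+1] is
   compensated by the mass above a node, so [overhead k.+1] is free of it. *)
Lemma values_level_mass F Z S k :
  (size (values Z S k))%:R * level_mass F k * weight F (overhead k) <=
  weight F (2 * k + 3).
Proof.
case: k => [|k]; first by rewrite mul1r mul1r weight_le.
apply: (@le_trans _ _ ((2 ^ log_values k * (2 ^ precision k + 1))%:R
    * weight F (precision k) * weight F (overhead k.+1))).
  rewrite /level_mass !ler_pM2r // ler_nat (leq_trans (size_valuesS Z S k)) // leq_mul2r.
  by rewrite size_values orbT.
(* The separate summand 1 pays for [(2 ^ precision k + 1) * weight F (precision k) <= 2]. *)
have -> : overhead k.+1 = (2 * k.+1 + 3 + 1 + log_values k)%N.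
  by rewrite /overhead /=; lia.
rewrite natrM natrD (weightD F (_ + 1)) (weightD F _ 1).
have e1 := weight_exp F (log_values k); have e2 := weight_exp F (precision k).
have y1 : weight F (precision k) <= 1 by rewrite -[1]/(weight F 0) weight_le.
have h1 : weight F 1 + weight F 1 = 1 := weightS F 0.
move: (weight F (2 * k.+1 + 3)) (weight_ge0 F (2 * k.+1 + 3)) e1 e2 y1 h1 => A A0.
move: (2 ^ log_values k)%:R (2 ^ precision k)%:R.
move: (weight F (log_values k)) (weight F (precision k)) (weight F 1).
move=> x y h X Y e1 e2 y1 h1.
have -> : X * (Y + 1%:R) * y * (A * h * x) = (X * x) * (Y * y + y) * h * A by ring.
rewrite e1 e2 mul1r -[leRHS]mul1r; nra.
Qed.

Lemma level_mass_ge0 F k : 0 <= level_mass F k.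
Proof. by case: k => [|k] /=. Qed.

(** At the stages where level [k] has the value [rho], the values of level [k.+1] form a chain of
    extensions. At the last one, [eta], all requested computations are present, so their weight is
    at most the gain from [rho] to [eta]. *)
Lemma sum_requested_node F S k a rho (r : seq nat) : uniq r ->
  (forall z, z \in r -> [/\ rq_k z = k, rq_a z = a & rq_rho z = rho]) ->
  (forall z, z \in r -> exists2 t, (t <= S)%N & requested t z) ->
  \sum_(z <- r) weight F (slen (rq_n z)) <= level_mass F k.
Proof.
move=> ur key rS; case: r ur key rS => [|z0 r] ur key rS.
  by rewrite big_nil level_mass_ge0.
set r' := z0 :: r in ur key rS *.
pose Q t := [&& (t <= S)%N, tree (sbit a) t k == rho & (tree (sbit a) t k.+1 < t)%N].
have rQ z : z \in r' -> exists2 t, Q t & [/\ halts (tree (sbit a) t k.+1) (rq_n z),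
    ~~ halts rho (rq_n z) & eval_fin U (tree (sbit a) t k.+1) (rq_n z) = (rq_x z).+1].
  move=> zr; have [t tS] := rS z zr; have [zk za zrho] := key z zr.
  rewrite /requested zk za zrho => /and5P[_ e lt h /andP[h' /eqP ev]].
  by exists t => //; rewrite /Q tS e lt.
have exQ : exists t, Q t by have [|t Qt _] := rQ z0; [rewrite inE eqxx|exists t].
have Qle t : Q t -> (t <= S)%N by case/and3P.
case: (ex_maxnP exQ Qle) => t Qt tmax.
have /and3P[_ /eqP e lt] := Qt.
set eta := tree (sbit a) t k.+1 in lt.
have reta z : z \in r' -> [/\ halts eta (rq_n z), ~~ halts rho (rq_n z) &
    eval_fin U eta (rq_n z) = (rq_x z).+1].
  move=> /rQ[u Qu [h h' ev]]; have /and3P[_ /eqP e' _] := Qu.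
  have pu : pre (tree (sbit a) u k.+1) eta.
    by rewrite /eta !treeS e e'; exact/best_pre/tmax.
  by split; [exact: halts_pre h | | exact: eval_fin_pre ev].
apply: (@le_trans _ _ (gain F rho eta)); last first.
  by rewrite -e; apply: tree_gain => //; exact: tree_pre.
rewrite -(big_map rq_n xpredT (fun n => weight F (slen n))).
apply: (@ler_sum_sub F (fun n => weight F (slen n)) _
  (fun n => halts eta n && ~~ halts rho n)) => //.
  (* Under [eta] the program determines its output, so distinct requests have distinct programs. *)
  rewrite map_inj_in_uniq // => y z yr zr en.
  have [yk ya yrho] := key y yr; have [zk za zrho] := key z zr.
  have [_ _ yx] := reta y yr; have [_ _ zx] := reta z zr.
  have ex : rq_x y = rq_x z by move: yx; rewrite en zx => -[].
  move: yk ya yrho en ex; rewrite -zk -za -zrho.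
  rewrite /rq_k /rq_a /rq_rho /rq_n /rq_x => e0 e1 e2 e3 e4.
  rewrite -[y]npairK -[nsnd y]npairK -[nsnd (nsnd y)]npairK.
  rewrite -[nsnd (nsnd (nsnd y))]npairK e0 e1 e2 e3 e4.
  by rewrite !npairK.
move=> n /mapP[z zr ->]; have [h h' _] := reta z zr.
by rewrite h h' !andbT; case/andP: h.
Qed.

(** Requests are grouped by level [k], initial segment [a] and value [rho]. Each [a] contributes at
    most [2^-(2k+3)], so level [k] contributes at most [2^-(k+1)]. *)
Lemma sum_requested F S (r : seq nat) : uniq r ->
  (forall z, z \in r -> exists2 t, (t <= S)%N & requested t z) ->
  \sum_(z <- r) weight F (slen (rq_n z) + overhead (rq_k z)) <= 1.
Proof.
move=> ur rS; pose g z := weight F (slen (rq_n z) + overhead (rq_k z)).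
pose K := \max_(z <- r) (rq_k z).+1.
have rK z : z \in r -> (rq_k z < K)%N.
  by move=> zr; rewrite /K (big_rem z) //= leq_max leqnn.
rewrite (sum_by_key _ _ rK) /=.
apply: le_trans (sum_weight_tail F 0 K); apply: ler_sum => k _.
rewrite -big_filter; set rk := [seq z <- r | _].
have rkr z : z \in rk -> z \in r /\ rq_k z = k.
  by rewrite mem_filter => /andP[/eqP -> ->].
have rkA z : z \in rk -> (rq_a z < 2 ^ k.+2)%N.
  by move=> /rkr[/rS[t _ /andP[+ _]] <-].
rewrite (sum_by_key _ _ rkA) /=.
apply: (@le_trans _ _ (\sum_(a < 2 ^ k.+2) weight F (2 * k + 3))); last first.
  rewrite sumr_const card_ord -[_ *+ _]mulr_natl.
  have -> : (2 * k + 3 = k.+2 + k.+1)%N by lia.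
  by rewrite weightD mulrA weight_exp mul1r.
apply: ler_sum => a _; rewrite -big_filter; set ra := [seq z <- rk | _].
have rar z : z \in ra -> z \in rk /\ rq_a z = a.
  by rewrite mem_filter => /andP[/eqP -> ->].
apply: le_trans (values_level_mass F (sbit a) S k).
apply: (@le_trans _ _ (\sum_(rho <- values (sbit a) S k)
   \sum_(z <- ra | rq_rho z == rho) g z)).
  apply: sum_by_seq_le => [z|z /rar[/rkr[/rS[t tS]]]]; first exact: weight_ge0.
  rewrite /requested => /and3P[_ /eqP <- _] -> ->; exact: tree_values.
rewrite -[size _]sum1_size natr_sum !mulr_suml; apply: ler_sum => rho _.
rewrite mul1r -big_filter; set rr := [seq z <- ra | _].
have rrr z : z \in rr -> [/\ z \in r, rq_k z = k, rq_a z = a & rq_rho z = rho].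
  by rewrite mem_filter => /andP[/eqP -> /rar[/rkr[-> ->] ->]].
apply: (@le_trans _ _ ((\sum_(z <- rr) weight F (slen (rq_n z))) * weight F (overhead k))).
  rewrite mulr_suml big_seq [leRHS]big_seq; apply: ler_sum => z /rrr[_ zk _ _].
  by rewrite /g zk weightD.
rewrite ler_pM2r //; apply: (@sum_requested_node F S k a rho).
- by rewrite !filter_uniq.
- by move=> z /rrr[].
- by move=> z /rrr[/rS].
Qed.

End Tree.

(** * Branches of the tree *)

#[local] Hint Resolve computable_overhead : comp.

Local Open Scope nat_scope.

Section Branches.
Context (U : program) (hU : universal_prefix_free_machine U).

Lemma tree_limit Z k : exists s, forall t, s <= t -> tree U Z t k = tree U Z s k.
Proof.
elim: k => [|k [s1 h1]]; first by exists 0.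
have [s2 h2] := best_limit hU (srcons (tree U Z s1 k) (Z k)) (precision k).
exists (maxn s1 s2) => t; rewrite geq_max => /andP[t1 t2].
by rewrite !treeS (h1 t) // (h1 (maxn s1 s2)) ?leq_maxl // !h2 ?leq_maxr.
Qed.

Definition node (Z : nat -> bool) (k : nat) : nat :=
  tree U Z (sval (cid (tree_limit Z k))) k.

Lemma nodeP Z k : exists s, forall t, s <= t -> tree U Z t k = node Z k.
Proof. by rewrite /node; case: cid => s h; exists s. Qed.

Lemma node_pre_srcons Z k : pre (srcons (node Z k) (Z k)) (node Z k.+1).
Proof.
have [s1 h1] := nodeP Z k; have [s2 h2] := nodeP Z k.+1.
rewrite -(h1 (maxn s1 s2)) ?leq_maxl // -(h2 (maxn s1 s2)) ?leq_maxr //.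
exact: tree_pre_srcons.
Qed.

Lemma eq_node Z Z' k : (forall i, i < k -> Z i = Z' i) -> node Z k = node Z' k.
Proof.
move=> e; have [s1 h1] := nodeP Z k; have [s2 h2] := nodeP Z' k.
rewrite -(h1 (maxn s1 s2)) ?leq_maxl // -(h2 (maxn s1 s2)) ?leq_maxr //.
exact: eq_tree.
Qed.

Lemma leq_slen_node Z k : k <= slen (node Z k).
Proof.
elim: k => [//|k IH]; apply: leq_ltn_trans IH _.
by have /preP[] := node_pre_srcons Z k; rewrite slen_srcons.
Qed.

Lemma node_pre Z i j : i <= j -> pre (node Z i) (node Z j).
Proof.
move=> /subnK <-; elim: (j - i) => [|m IH]; first exact: pre_refl.
exact: (pre_trans IH (pre_trans (pre_srcons _ _) (node_pre_srcons Z _))).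
Qed.

(** The node of level [i.+1] is longer than [i], so bit [i] is never read beyond its end. *)
Definition branch (Z : nat -> bool) : cantor_space := fun i => sbit (node Z i.+1) i.

Lemma agree_branch Z k : agree (node Z k) (branch Z).
Proof.
move=> i lt; rewrite /branch.
have /preP[_ e1] := node_pre Z (leq_maxl k i.+1).
have /preP[_ e2] := node_pre Z (leq_maxr k i.+1).
by rewrite e1 // e2 //; exact: leq_slen_node.
Qed.

(** The bit of a branch right after its node of level [k] is the one appended by [srcons], so it
    records [Z k]. *)
Lemma branch_sep Z Z' k : (forall i, i < k -> Z i = Z' i) ->
  branch Z (slen (node Z k)) = branch Z' (slen (node Z k)) -> Z k = Z' k.
Proof.
move=> e; have lt Y : slen (node Y k) < slen (node Y k.+1).
  by have /preP[] := node_pre_srcons Y k; rewrite slen_srcons.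
have bit Y : branch Y (slen (node Y k)) = Y k.
  rewrite -(@agree_branch Y k.+1) //.
  have /preP[_ <-] := node_pre_srcons Y k; first exact: sbit_srcons.
  by rewrite slen_srcons.
by rewrite bit (eq_node e) bit.
Qed.

(** A shortest program of [x] relative to the branch uses a finite part of it and hence halts on
    some node; [k.+1] is the least level where it does. *)
Lemma branch_level Z x : exists k n, [/\ halts U (node Z k.+1) n,
  ~~ halts U (node Z k) n, eval_fin U (node Z k.+1) n = x.+1
  & slen n = complexity U (branch Z) x].
Proof.
have [p sp px] := complexity_witness hU (branch Z) x.
have [N NP] := eval_fin_complete px.
set n := str_code p in NP px.
pose M := maxn N n.+1.
have slM : M <= slen (node Z M) := leq_slen_node Z M.
have eM : eval_fin U (node Z M) n = x.+1.
  apply: NP; first exact: agree_branch.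
  by apply: leq_trans slM; rewrite leq_maxl.
have ex : exists k, halts U (node Z k) n.
  exists M; rewrite /halts eM andbT; apply: leq_trans slM.
  by rewrite leq_maxr.
(* The root codes the empty string, on which nothing counts as halting. *)
case: (ex_minnP ex) => -[|k] hk kmin; first by rewrite /halts /slen /nsum big_ord0 in hk.
exists k, n; split=> //.
- by apply/negP => /kmin; rewrite ltnn.
- move: hk => /andP[_]; case e: (eval_fin _ _ _) => [|y] // _.
  have kM : k.+1 <= M.
    by apply: kmin; rewrite /halts eM andbT; apply: leq_trans slM; rewrite leq_maxr.
  by rewrite -eM (eval_fin_pre (node_pre Z kM) e).
- by rewrite slen_code.
Qed.

(** A single oracle-free machine serves all branches, because a request names only the first [k.+1]
    bits of [Z]. *)
Lemma low_branch : exists c, forall Z k n x, halts U (node Z k.+1) n ->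
  ~~ halts U (node Z k) n -> eval_fin U (node Z k.+1) n = x.+1 ->
  complexity U empty_oracle x <= slen n + overhead k + c.
Proof.
have [||||c cP] := @kraft_chaitin rat U (requested U)
    (fun z => slen (rq_n z) + overhead (rq_k z)) rq_x hU.
- exact: decidable_requested.
- by rewrite /rq_n /rq_k; comp.
- by rewrite /rq_x; comp.
- by move=> S s us sR; exact: (sum_requested hU rat us sR).
exists c => Z k n x h h' e.
pose a := initial Z k.+1.
have aZ i : i < k.+1 -> sbit a i = Z i.
  by move=> lt; apply: agree_initial; rewrite slen_initial.
have [s1 h1] := nodeP Z k; have [s2 h2] := nodeP Z k.+1.
(* At this stage both levels have settled, and the value of level [k.+1] is below [s], as
   [requested] demands. *)
pose s := maxn (maxn s1 s2) (node Z k.+1).+1.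
have e1 : tree U (sbit a) s k = node Z k.
  rewrite (@eq_tree _ _ Z) => [|i lt]; first by apply: h1; rewrite !leq_max leqnn.
  by apply: aZ; exact: ltnW.
have e2 : tree U (sbit a) s k.+1 = node Z k.+1.
  by rewrite (@eq_tree _ _ Z) => [|i /aZ//]; apply: h2; rewrite !leq_max leqnn orbT.
pose z := npair k (npair a (npair (node Z k) (npair n x))).
have [|p] := cP empty_oracle s z.
  rewrite /requested /rq_a /rq_k /rq_rho /rq_n /rq_x !nprE e1 e2 h h' e !eqxx.
  rewrite /= andbT leq_max leqnn orbT andbT.
  by have /andP[_] := slen_bounds a; rewrite slen_initial => /ltnW.
rewrite /rq_k /rq_n /rq_x !nprE => <-; exact: complexity_le.
Qed.

Local Open Scope ring_scope.

(** * The information sum along a branch *)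

Lemma node_gain F Z k t : pre (node Z k) t -> gain U F (node Z k) t <= level_mass F k.
Proof.
have [s h] := nodeP Z k; have e := h (maxn s t.+1) (leq_maxl _ _).
by rewrite -e => st; apply: tree_gain => //; rewrite leq_maxr.
Qed.

(** The precisions are chosen for this: [precision k] is [2 * overhead k.+1 + k.+1], so level [k.+1]
    contributes [2^-(k+1)]. Level 0 contributes [2^8] because [overhead 0 = 4]. *)
Lemma sum_level_mass (F : realFieldType) M :
  \sum_(k < M) 2%:R ^+ (2 * overhead k) * level_mass F k <= 2%:R ^+ 8 + 1.
Proof.
case: M => [|M]; first by rewrite big_ord0 addr_ge0 // exprn_ge0 // ler0n.
rewrite big_ord_recl /= mulr1; apply: lerD; first by [].
apply: le_trans (sum_weight_tail F 0 M); apply: ler_sum => k _.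
rewrite /bump /= add1n.
have -> : precision k = (2 * overhead k.+1 + k.+1)%N.
  by rewrite /precision /overhead /=; lia.
by rewrite weightD mulrA -natrX weight_exp mul1r.
Qed.

Definition info_ratio (F : realFieldType) (A : cantor_space) (x : nat) : F :=
  weight F (complexity U A x) / weight F (complexity U empty_oracle x).

Lemma info_ratio_ge0 F A x : 0 <= info_ratio F A x.
Proof. by rewrite /info_ratio divr_ge0. Qed.

(** Values [x] are grouped by the level of a shortest program: at level [k] the ratio is at most
    [2^(overhead k + c)] by [low_branch], and the programs weigh at most [level_mass F k] by
    [node_gain]. *)
Lemma sum_info_ratio (F : realFieldType) : exists B : F,
  forall Z (s : seq nat), uniq s ->
  \sum_(x <- s) info_ratio F (branch Z) x ^+ 2
    * weight F (complexity U (branch Z) x) <= B.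
Proof.
have [c cP] := low_branch.
exists (2%:R ^+ (2 * c) * (2%:R ^+ 8 + 1)) => Z s us.
have /boolp.choice[kn knP] : forall x, exists kn : nat * nat,
  [/\ halts U (node Z kn.1.+1) kn.2,
  ~~ halts U (node Z kn.1) kn.2, eval_fin U (node Z kn.1.+1) kn.2 = x.+1
  & slen kn.2 = complexity U (branch Z) x].
  by move=> x; have [k [n h]] := branch_level Z x; exists (k, n).
pose M := \max_(x <- s) (kn x).1.+1.
have kM x : x \in s -> ((kn x).1 < M)%N.
  by move=> xs; rewrite /M (big_rem x) //= leq_max leqnn.
rewrite (sum_by_key _ _ kM) /=.
apply: le_trans (ler_wpM2l _ (sum_level_mass F M)); last first.
  by rewrite exprn_ge0 // ler0n.
rewrite mulr_sumr; apply: ler_sum => k _.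
apply: (@le_trans _ _ (\sum_(x <- s | (kn x).1 == k)
    2%:R ^+ (2 * c) * 2%:R ^+ (2 * overhead k) * weight F (slen (kn x).2))).
  apply: ler_sum => x /eqP xk; have [h h' e ->] := knP x.
  rewrite ler_pM2r // -exprD -mulnDr mulnC exprM.
  have := cP Z _ _ _ h h' e; rewrite xk -(weight_le F) => le.
  rewrite ler_pXn2r ?nnegrE ?exprn_ge0 ?ler0n ?info_ratio_ge0 //.
  rewrite /info_ratio ler_pdivrMr //.
  have [_ _ _ <-] := knP x.
  apply: le_trans (ler_wpM2l _ le); last by rewrite exprn_ge0 // ler0n.
  have -> : (slen (kn x).2 + overhead k + c = c + overhead k + slen (kn x).2)%N by lia.
  by rewrite (weightD F (c + overhead k)) mulrA -natrX weight_exp mul1r.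
rewrite -mulr_sumr -mulrA ler_wpM2l // ?exprn_ge0 ?ler0n // ler_wpM2l //.
apply: le_trans (node_gain F (node_pre Z (leqnSn k))).
rewrite -big_filter -(big_map (fun x => (kn x).2) xpredT (fun n => weight F (slen n))).
apply: (@ler_sum_sub F (fun n => weight F (slen n)) _
  (fun n => halts U (node Z k.+1) n && ~~ halts U (node Z k) n)) => //.
  rewrite map_inj_in_uniq ?filter_uniq // => x y.
  rewrite !mem_filter => /andP[/eqP xk _] /andP[/eqP yk _] e.
  have [_ _ ex _] := knP x; have [_ _ ey _] := knP y.
  by move: ex ey; rewrite e xk yk => -> [].
move=> n /mapP[x]; rewrite mem_filter => /andP[/eqP xk _] ->.
have [h h' _ _] := knP x; rewrite xk in h h'.
by rewrite h h' andbT andbT; case/andP: h.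
Qed.

(** The sum over the fibre of [f] at [x] is handled by the coding theorem; relativization then
    replaces [K(x)] by [K^A(x)]. Both projections of a pair are instances. *)
Lemma sum_info_proj (F : realFieldType) (f : nat -> nat) : computable f ->
  exists B : F, forall Z (s : seq nat), uniq s ->
  \sum_(z <- s) info_ratio F (branch Z) (f z) ^+ 2
    * weight F (complexity U empty_oracle z) <= B.
Proof.
move=> fC; have [B BP] := sum_info_ratio F.
have [c1 c1P] := coding_theorem hU F fC; have [c2 c2P] := complexity_relativize hU.
exists (2%:R ^+ (c1 + c2) * B) => Z s us; set A := branch Z.
pose r x := info_ratio F A x ^+ 2.
have r0 x : 0 <= r x by rewrite exprn_ge0 // info_ratio_ge0.
pose V := undup [seq f z | z <- s].
apply: (@le_trans _ _ (\sum_(x <- V) \sum_(z <- s | f z == x)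
   r (f z) * weight F (complexity U empty_oracle z))).
  apply: sum_by_seq_le => [z|z zs]; first exact: mulr_ge0 (r0 _) (weight_ge0 _ _).
  by rewrite mem_undup map_f.
have ge0 n : 0 <= (2%:R : F) ^+ n by rewrite exprn_ge0 // ler0n.
apply: le_trans (ler_wpM2l (ge0 _) (BP Z V (undup_uniq _))).
rewrite mulr_sumr; apply: ler_sum => x _.
rewrite mulrCA.
rewrite (eq_bigr (fun z => r x * weight F (complexity U empty_oracle z))); last first.
  by move=> z /eqP ->.
rewrite -mulr_sumr -/(r x); apply: ler_wpM2l => //.
apply: (@le_trans _ _ (2%:R ^+ c1 * weight F (complexity U empty_oracle x))).
  by rewrite -big_filter; apply: c1P; rewrite ?filter_uniq // => z;
    rewrite mem_filter => /andP[/eqP].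
rewrite exprD -mulrA ler_wpM2l //.
have := c2P A x; rewrite -(weight_le F) => le.
apply: le_trans (ler_wpM2l (ge0 _) le).
by rewrite addnC weightD mulrA -natrX weight_exp mul1r.
Qed.

Lemma sum_info (F : realFieldType) : exists B : F, forall Z (s : seq nat), uniq s ->
  \sum_(z <- s) info_ratio F (branch Z) (nfst z) * info_ratio F (branch Z) (nsnd z)
    * weight F (complexity U empty_oracle z) <= B.
Proof.
have [B1 h1] := sum_info_proj F computable_fst_id.
have [B2 h2] := sum_info_proj F computable_snd_id.
exists (B1 + B2) => Z s us.
apply: le_trans (lerD (h1 Z s us) (h2 Z s us)).
rewrite -big_split /=; apply: ler_sum => z _; rewrite -mulrDl ler_wpM2r //.
move: (info_ratio _ _ _) (info_ratio _ _ _) => a b; nra.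
Qed.

End Branches.

(** * The perfect set *)

Local Open Scope nat_scope.
Local Open Scope classical_set_scope.

Lemma nbhs_cylinder (A : cantor_space) n :
  nbhs A [set B : cantor_space | forall i, i < n -> B i = A i].
Proof.
elim: n => [|n IH]; first by apply: filterS filterT => B _ i.
have An : nbhs A [set B : cantor_space | B n = A n].
  have := @proj_continuous nat (fun=> bool) n A [set A n].
  by apply; exact: discrete_set1.
apply: filterS (filterI IH An) => B [/= e en] i.
by rewrite ltnS leq_eqVlt => /predU1P[->//|]; exact: e.
Qed.

(** It suffices that the filter generated by the cylinders around [A] converges to [A], which in the
    product topology is checked one coordinate at a time. *)
Lemma nbhs_cylinderP (A : cantor_space) (X : set cantor_space) : nbhs A X ->
  exists n, forall B : cantor_space, (forall i, i < n -> B i = A i) -> X B.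
Proof.
pose cyl n := [set B : cantor_space | forall i, i < n -> B i = A i].
pose F := filter_from [set: nat] cyl.
have FF : Filter F.
  apply: filter_from_filter; first by exists 0.
  move=> m n _ _; exists (maxn m n) => // B e; split=> i lt; apply: e;
    by rewrite (leq_trans lt) // ?leq_maxl ?leq_maxr.
suff FA : F --> A by move=> /FA[n _ h]; exists n => B e; exact: h.
apply/cvg_sup => i Y [_ [[Z oZ <-] ZA] ZY].
exists i.+1 => // B e; apply: ZY; rewrite /= e //.
Qed.

Section Perfect.
Context (U : program) (hU : universal_prefix_free_machine U).

Lemma eq_branch n (Z Z' : nat -> bool) : (forall i, i < n -> Z i = Z' i) ->
  forall i, i < n -> branch hU Z i = branch hU Z' i.
Proof.
move=> e i lt; rewrite /branch (@eq_node _ _ Z Z') // => j lt_j.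
by apply: e; apply: leq_trans lt.
Qed.

Lemma branch_continuous : continuous (branch hU : cantor_space -> cantor_space).
Proof.
move=> Z X /nbhs_cylinderP[n nX]; apply: filterS (nbhs_cylinder Z n) => Z' /= e.
by apply: nX; exact: eq_branch.
Qed.

(** The range is a continuous image of a compact space in a Hausdorff space, hence closed. Flipping
    bit [n] of [Z] gives a different branch with the same first [n] bits, so no point is
    isolated. *)
Lemma perfect_branches : perfect_set (range (branch hU : cantor_space -> cantor_space)).
Proof.
have cl : closed (range (branch hU : cantor_space -> cantor_space)).
  apply: compact_closed; first exact: cantor_space_hausdorff.
  apply: continuous_compact cantor_space_compact.
  by apply: continuous_subspaceT => Z; exact: branch_continuous.
split=> //; apply/seteqP; split=> [A /subset_limit_point|].
  by rewrite -(closure_id _).1.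
move=> _ [Z _ <-] X /nbhs_cylinderP[n nX].
pose Z' i := if i == n then ~~ Z n else Z i.
have e i : i < n -> Z' i = Z i by rewrite /Z' ltn_neqAle => /andP[/negbTE ->].
exists (branch hU Z'); split.
- apply/eqP => eb; have := branch_sep e (congr1 (fun A => A (slen (node hU Z' n))) eb).
  by rewrite /Z' eqxx; case: (Z n).
- by exists Z'.
- by apply: nX; exact: eq_branch.
Qed.

Local Open Scope ring_scope.

Lemma information_termE (R : realType) A s t : information_term R U A A s t =
  info_ratio U R A (str_code s) * info_ratio U R A (str_code t) *
  weight R (complexity U empty_oracle (npair (str_code s) (str_code t))).
Proof.
rewrite /information_term /info_ratio /K /Krel /Kpair /str_pair_code.
have two : (2%:R : R) != 0 by rewrite pnatr_eq0.
rewrite /weight !exprVn !invrK !expfzDr // !exprnN -!exprnP.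
by ring.
Qed.

Lemma finite_self_information_branch (R : realType) Z :
  finite_self_information R U (branch hU Z).
Proof.
have [B BP] := sum_info hU R.
suff le : (\esum_(st in [set: bitseq * bitseq])
   (information_term R U (branch hU Z) (branch hU Z) st.1 st.2)%:E <= B%:E)%E.
  rewrite /finite_self_information /mutual_information /log2e.
  have : ((\esum_(st in [set: bitseq * bitseq])
   (information_term R U (branch hU Z) (branch hU Z) st.1 st.2)%:E) < +oo)%E.
    exact: le_lt_trans le (ltry _).
  (* The logarithm is real or [-oo]; in the latter case multiplying by the positive number
     [1 / ln 2] leaves [-oo]. *)
  case: (\esum_(_ in _) _) => [r| |] //= _.
    case: ifP => _; last by rewrite -EFinM ltry.
    by rewrite mulNyr gtr0_sg ?mul1e // invr_gt0 ln_gt0 // ltr1n.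
  by rewrite mulNyr gtr0_sg ?mul1e // invr_gt0 ln_gt0 // ltr1n.
(* The infinite sum is the supremum of its finite subsums, so the bound over duplicate-free lists is
   enough. *)
apply: ge_ereal_sup => _ [A [finA _] <-].
rewrite fsbig_finite //= sumEFin lee_fin.
pose code (st : bitseq * bitseq) := npair (str_code st.1) (str_code st.2).
apply: le_trans (BP Z [seq code st | st <- finmap.enum_fset (fset_set A)] _).
  rewrite big_map le_eqVlt; apply/orP; left; apply/eqP; apply: eq_bigr => st _.
  by rewrite information_termE !nprE.
rewrite map_inj_uniq ?finmap.fset_uniq // => -[s t] [s' t'] /= e.
have := congr1 nfst e; have := congr1 nsnd e; rewrite !nprE /=.
by move=> /(can_inj str_codeK) -> /(can_inj str_codeK) ->.
Qed.

End Perfect.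

Theorem theorem1p4 (R : realType) (U : program)
    (hU : universal_prefix_free_machine U) :
  exists P : set cantor_space,
    [/\ P !=set0, perfect_set P
      & forall A : cantor_space, P A -> finite_self_information R U A].
Proof.
exists (range (branch hU : cantor_space -> cantor_space)); split.
- by exists (branch hU (fun=> false)), (fun=> false).
- exact: perfect_branches.
- by move=> _ [Z _ <-]; exact: finite_self_information_branch.
Qed.
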